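(* (a) Let $(T/\!\sim,\{P_i\}_{i=1}^p,\{V_j\}_{j=1}^q)$ be a triple (see context). Let $\Gamma$ be the algebra generated by $P_1,\dots,P_p$ and all matrices $E_{\mathcal I}=\sum_{j\in\mathcal I}e_{jj}$ ($\mathcal I\in T/\!\sim$), and let $\mathcal M$ be the smallest subspace of $k^{t\times t}$ containing $V_1,\dots,V_q$ and closed under left and right multiplication by $P_1,\dots,P_p$. Then $\Gamma$ is a basic matrix algebra whose associated equivalence relation is $\sim$, $\Gamma\mathcal M\subset\mathcal M$, $\mathcal M\Gamma\subset\mathcal M$, and for every step-sequence $\underline n$: $\mathcal M^{\rm tr}_{\underline n\times\underline n}=\mathcal M_{\underline n\times\underline n}$, and two matrices of this space are triple-equivalent if and only if they are $\Gamma_{\underline n\times\underline n}$-similar. (b) Conversely, let $(\Gamma,\mathcal M)$ be a linear matrix problem with $\Gamma\subset k^{t\times t}$, let $\mathcal I_1,\dots,\mathcal I_r$ be the classes of the equivalence relation of $\Gamma$, $E_\alpha=\sum_{i\in\mathcal I_\alpha}e_{ii}$, and $\mathcal R$ the set of matrices of $\Gamma$ with zero diagonal. Let $\{P_i\}_{i=1}^p$ be the union of bases of the spaces $E_\alpha\mathcal R E_\beta$ and $\{V_j\}_{j=1}^q$ the union of bases of the spaces $E_\alpha\mathcal M E_\beta$ ($1\le\alpha,\beta\le r$). Then $(\{\mathcal I_1,\dots,\mathcal I_r\},\{P_i\},\{V_j\})$ is a triple, and for every step-sequence $\underline n$: $\mathcal M^{\rm tr}_{\underline n\times\underline n}=\mathcal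 M_{\underline n\times\underline n}$, and two matrices of this space are triple-equivalent if and only if they are $\Gamma_{\underline n\times\underline n}$-similar.
   Context: $k$ is an algebraically closed field; $e_{ij}$ denotes a matrix unit. Let $\sim$ be an equivalence relation on $T=\{1,\dots,t\}$. A $t\times t$ matrix $A=[a_{ij}]$ links a class $\mathcal I$ to a class $\mathcal J$ if $a_{ij}\neq0$ implies $(i,j)\in\mathcal I\times\mathcal J$. A step-sequence is $\underline n=(n_1,\dots,n_t)$, $n_i\ge0$, with $n_i=n_j$ whenever $i\sim j$; an $\underline n\times\underline n$ matrix is $M=[M_{ij}]$ with blocks $M_{ij}\in k^{n_i\times n_j}$. For $A$ linking $\mathcal I$ to $\mathcal J$ and $(l,r)\in\{1,\dots,n_i\}\times\{1,\dots,n_j\}$ ($(i,j)\in\mathcal I\times\mathcal J$), $A^{[l,r]}$ is the $\underline n\times\underline n$ matrix obtained from $A$ by replacing each $a_{ij}$ by the $n_i\times n_j$ block that is $0$ if $a_{ij}=0$ and otherwise has $(l,r)$ entry $a_{ij}$ and all other entries $0$. A triple $(T/\!\sim,\{P_i\}_{i=1}^p,\{V_j\}_{j=1}^q)$ consists of the set of classes of $\sim$, a finite (possibly empty) set of nilpotent upper triangular matrices $P_i\in k^{t\times t}$ each linking some class to some class, and a finite set of matrices $V_j\in k^{t\times t}$ each linking some class to some class. Let $\mathcal P$ be the set of all products of the $P_i$ and $\mathcal V=\{PV_jP'\mid P,P'\in\{I_t\}\cup\mathcal P,1\le j\le q\}$. For a step-sequence $\underline n$, $\mathcal M^{\rm tr}_{\underline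 n\times\underline n}$ is the span of all $V^{[l,r]}$ with $0\ne V\in\mathcal V$. Two matrices of $\mathcal M^{\rm tr}_{\underline n\times\underline n}$ are triple-equivalent if one is obtained from the other by a finite sequence of transformations: (i) $M\mapsto S^{-1}MS$, where for a class $\mathcal I$ and an elementary invertible matrix $E$ of the common size $n_i$ ($i\in\mathcal I$), $S$ is block-diagonal with $S_{ii}=E$ for $i\in\mathcal I$ and $S_{ii}=I$ otherwise; (ii) $M\mapsto(I+aP^{[l,r]})^{-1}M(I+aP^{[l,r]})$ with $a\in k$, $0\ne P\in\mathcal P$. A basic matrix algebra is a subalgebra $\Gamma\subset k^{t\times t}$ (containing $I_t$) of upper triangular matrices such that the diagonal part of each element of $\Gamma$ lies in $\Gamma$; its diagonal matrices are spanned by 0–1 idempotents $E_\alpha=\sum_{i\in\mathcal I_\alpha}e_{ii}$ with $\sum E_\alpha=I$, and the classes $\mathcal I_\alpha$ define its equivalence relation; $\Gamma$ is the set of upper triangular $[s_{ij}]$ with $s_{ii}=s_{jj}$ for $i,j$ in the same class and whose entries satisfy certain linear systems $\sum_{\mathcal I\ni i<j\in\mathcal J}c^{(l)}_{ij}x_{ij}=0$, one system per pair of classes. A linear matrix problem is a pair $(\Gamma,\mathcal M)$, $\Gamma$ a basic $t\times t$ algebra, $\mathcal M\subset k^{t\times t}$ a subspace with $\Gamma\mathcal M\subset\mathcal M$, $\mathcal M\Gamma\subset\mathcal M$; $\mathcal M$ is the solution space of a linear system whose equations each involve only entries $x_{ij}$, $(i,j)\in\mathcal I\times\mathcal J$,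 for one pair of classes. For a step-sequence $\underline n$, $\Gamma_{\underline n\times\underline n}$ is the algebra of upper block-triangular $\underline n\times\underline n$ matrices $S$ with $S_{ii}=S_{jj}$ for equivalent $i,j$ and whose blocks satisfy the same equations $\sum c^{(l)}_{ij}S_{ij}=0$; $\mathcal M_{\underline n\times\underline n}$ is the space of $\underline n\times\underline n$ matrices whose blocks satisfy the equations defining $\mathcal M$. $M,N$ are $\Gamma_{\underline n\times\underline n}$-similar if $N=S^{-1}MS$ with $S$ invertible in $\Gamma_{\underline n\times\underline n}$. *)

(* Defs.v *)
From HB Require Import structures.
From Stdlib Require Import Relations.Relation_Operators.
From mathcomp Require Import all_boot all_order all_algebra.
Set Implicit Arguments. Unset Strict Implicit. Unset Printing Implicit Defensive.
Import Order.TTheory GRing.Theory Num.Theory.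
Local Open Scope ring_scope.

Section Defs.
Variables (k : fieldType) (t : nat).
Implicit Types (eqv : rel 'I_t) (A B P V X Y : 'M[k]_t).

Definition upper_tri A := forall i j : 'I_t, (j < i)%N -> A i j = 0.
Definition strict_upper A := forall i j : 'I_t, (j <= i)%N -> A i j = 0.
Definition mx_nilpotent A := exists m : nat, iter m (mulmx A) 1%:M = 0.

Definition links eqv A (i0 j0 : 'I_t) :=
  forall i j : 'I_t, A i j != 0 -> eqv i0 i && eqv j0 j.
Definition links_some eqv A := exists i0 j0, links eqv A i0 j0.

Definition Ecls eqv (i0 : 'I_t) : 'M[k]_t :=
  \matrix_(i, j) ((i == j) && eqv i0 i)%:R.

Definition is_triple eqv (Ps Vs : seq 'M[k]_t) :=
  equivalence_rel eqv /\
  (forall P, P \in Ps -> [/\ mx_nilpotent P, upper_tri P & links_some eqv P]) /\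
  (forall V, V \in Vs -> links_some eqv V).

Definition isProd (Ps : seq 'M[k]_t) P :=
  exists w : seq 'M[k]_t, w != [::] /\ {subset w <= Ps} /\
                          P = foldr mulmx 1%:M w.
Definition inV (Ps Vs : seq 'M[k]_t) V :=
  exists P P' V0, [/\ V0 \in Vs, P = 1%:M \/ isProd Ps P,
                      P' = 1%:M \/ isProd Ps P' & V = P *m V0 *m P'].

Definition subspace (S : 'M[k]_t -> Prop) :=
  S 0 /\ (forall X Y, S X -> S Y -> S (X + Y)) /\ (forall (c : k) X, S X -> S (c *: X)).
Definition subalgebra (S : 'M[k]_t -> Prop) :=
  subspace S /\ S 1%:M /\ (forall X Y, S X -> S Y -> S (X *m Y)).

Definition gen_alg eqv (Ps : seq 'M[k]_t) : 'M[k]_t -> Prop := fun A =>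
  forall G : 'M[k]_t -> Prop, subalgebra G ->
    (forall P, P \in Ps -> G P) -> (forall i0, G (Ecls eqv i0)) -> G A.

Definition gen_bimod (Ps Vs : seq 'M[k]_t) : 'M[k]_t -> Prop := fun A =>
  forall W : 'M[k]_t -> Prop, subspace W -> (forall V, V \in Vs -> W V) ->
    (forall P Y, P \in Ps -> W Y -> W (P *m Y) /\ W (Y *m P)) -> W A.

(* Presentation of Gamma by linear equations sum_{I∋i<j∈J} c_ij x_ij = 0,
   one system per pair of classes; each equation is encoded by its
   coefficient matrix C (strictly upper, linking one pair of classes). *)
Definition presG eqv (Cs : seq 'M[k]_t) (G : 'M[k]_t -> Prop) :=
  (forall C, C \in Cs -> strict_upper C /\ links_some eqv C) /\
  (forall S, G S <-> [/\ upper_tri S, (forall i j, eqv i j -> S i i = S j j) &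
                         forall C, C \in Cs -> \sum_i \sum_j C i j * S i j = 0]).

Definition basic_mx_alg (G : 'M[k]_t -> Prop) eqv :=
  [/\ equivalence_rel eqv, subalgebra G,
      (forall S, G S -> upper_tri S) /\
      (forall S, G S -> G (\matrix_(i, j) ((i == j)%:R * S i j))),
      (* diagonal matrices of G = span of the 0-1 idempotents E_alpha of the
         classes of eqv, i.e. diagonal matrices constant on classes *)
      (forall D, is_diag_mx D ->
         (G D <-> forall i j, eqv i j -> D i i = D j j)) &
      exists Cs, presG eqv Cs G].

Definition presM eqv (Ds : seq 'M[k]_t) (M : 'M[k]_t -> Prop) :=
  (forall D, D \in Ds -> links_some eqv D) /\
  (forall X, M X <-> forall D, D \in Ds -> \sum_i \sum_j D i j * X i j = 0).

Definition lin_mx_problem (G : 'M[k]_t -> Prop) eqv (M : 'M[k]_t -> Prop) :=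
  [/\ basic_mx_alg G eqv, subspace M,
      (forall S X, G S -> M X -> M (S *m X) /\ M (X *m S)) &
      exists Ds, presM eqv Ds M].

Definition Rad (G : 'M[k]_t -> Prop) : 'M[k]_t -> Prop :=
  fun Y => G Y /\ forall i, Y i i = 0.

Definition sandwich eqv (S : 'M[k]_t -> Prop) (a b : 'I_t) : 'M[k]_t -> Prop :=
  fun X => exists Y, S Y /\ X = Ecls eqv a *m Y *m Ecls eqv b.

Definition is_basis (S : 'M[k]_t -> Prop) (B : seq 'M[k]_t) :=
  free B /\ forall X, S X <-> X \in <<B>>%VS.

Definition class_reps eqv (reps : seq 'I_t) :=
  (forall i, exists2 j, j \in reps & eqv i j) /\
  (forall a b, a \in reps -> b \in reps -> eqv a b -> a = b).

Definition step_seq eqv (n : 'I_t -> nat) := forall i j, eqv i j -> n i = n j.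

Definition bsz (n : 'I_t -> nat) : nat := (\sum_(i < t) n i)%N.

Definition nth_mx m1 m2 (A : 'M[k]_(m1, m2)) (a b : nat) : k :=
  match insub a, insub b with
  | Some a', Some b' => A a' b'
  | _, _ => 0
  end.

Definition bent (n : 'I_t -> nat) (S : 'M[k]_(bsz n)) (i j : 'I_t) (a b : nat) : k :=
  nth_mx (submxblock S i j) a b.

(* A^{[l,r]} (l, r counted from 0) *)
Definition mx_lr (n : 'I_t -> nat) A (l r : nat) : 'M[k]_(bsz n) :=
  mxblock (fun i j : 'I_t =>
    A i j *: (\matrix_(a < n i, b < n j) ((a == l :> nat) && (b == r :> nat))%:R)).

Definition valid_lr eqv (n : 'I_t -> nat) A (l r : nat) :=
  exists i0 j0, [/\ links eqv A i0 j0, (l < n i0)%N & (r < n j0)%N].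

Definition inSpan m (S : 'M[k]_m -> Prop) (X : 'M[k]_m) :=
  exists s : seq (k * 'M[k]_m), (forall x, x \in s -> S x.2) /\
                                X = \sum_(x <- s) x.1 *: x.2.

Definition Mtr eqv (Ps Vs : seq 'M[k]_t) (n : 'I_t -> nat) : 'M[k]_(bsz n) -> Prop :=
  inSpan (fun Z : 'M[k]_(bsz n) => exists V l r,
            [/\ inV Ps Vs V, V != 0, valid_lr eqv n V l r & Z = mx_lr n V l r]).

Definition elementary m (E : 'M[k]_m) :=
  (exists u v : 'I_m, E = tperm_mx u v) \/
  (exists (u : 'I_m) (c : k), c != 0 /\
       E = \matrix_(a, b) (if a == b then (if a == u then c else 1) else 0)) \/
  (exists (u v : 'I_m) (c : k), u != v /\ E = 1%:M + c *: delta_mx u v).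

Definition Sdiag eqv (n : 'I_t -> nat) (i0 : 'I_t) (E : 'M[k]_(n i0)) : 'M[k]_(bsz n) :=
  mxdiag (fun i : 'I_t => \matrix_(a < n i, b < n i)
            (if eqv i0 i then nth_mx E a b else (a == b :> nat)%:R)).

Definition tstep eqv (Ps : seq 'M[k]_t) (n : 'I_t -> nat) (X Y : 'M[k]_(bsz n)) :=
  (exists (i0 : 'I_t) (E : 'M[k]_(n i0)),
      elementary E /\ Y = invmx (Sdiag eqv E) *m X *m Sdiag eqv E) \/
  (exists P (a : k) (l r : nat),
      [/\ isProd Ps P, P != 0, valid_lr eqv n P l r &
          Y = invmx (1%:M + a *: mx_lr n P l r) *m X *m (1%:M + a *: mx_lr n P l r)]).

Definition tequiv eqv (Ps : seq 'M[k]_t) (n : 'I_t -> nat) (X Y : 'M[k]_(bsz n)) :=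
  Relation_Operators.clos_refl_trans _ (@tstep eqv Ps n) X Y \/
  Relation_Operators.clos_refl_trans _ (@tstep eqv Ps n) Y X.

Definition Gblk eqv (Cs : seq 'M[k]_t) (n : 'I_t -> nat) (S : 'M[k]_(bsz n)) :=
  [/\ (forall i j : 'I_t, (j < i)%N -> submxblock S i j = 0),
      (forall i j, eqv i j -> forall a b, bent S i i a b = bent S j j a b) &
      (forall C, C \in Cs -> forall a b, \sum_i \sum_j C i j * bent S i j a b = 0)].

Definition Mblk (Ds : seq 'M[k]_t) (n : 'I_t -> nat) (X : 'M[k]_(bsz n)) :=
  forall D, D \in Ds -> forall a b, \sum_i \sum_j D i j * bent X i j a b = 0.

Definition gsim eqv (Cs : seq 'M[k]_t) (n : 'I_t -> nat) (X Y : 'M[k]_(bsz n)) :=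
  exists S, [/\ Gblk eqv Cs S, S \in unitmx, Gblk eqv Cs (invmx S) &
                Y = invmx S *m X *m S].

End Defs.

Arguments Mtr {k t} eqv Ps Vs n _.
Arguments Mblk {k t} Ds n _.
Arguments Gblk {k t} eqv Cs n _.
Arguments tstep {k t} eqv Ps n _ _.
Arguments tequiv {k t} eqv Ps n _ _.
Arguments gsim {k t} eqv Cs n _ _.

(* Main.v *)
(** Writing [slice a b S] for the t x t matrix of the (a, b) entries of all blocks of
    S, block matrices become matrices over k^(t x t): S lies in the block algebra of
    Gamma (resp. the block space of M) exactly when all its slices lie in Gamma
    (resp. M), and A^[l,r] is the matrix whose only nonzero slice is A, at (l, r).
    The algebra generated by the P_i and the E_I is the sum of the class-constant
    diagonal matrices and the span R of the products of the P_i, and the bimodule is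
    the span of the P V_j P'; the spans of the P^[l,r] and V^[l,r] are therefore the
    block versions of R and M.  An invertible S in the block algebra factors as
    D (1 + N), with D block diagonal and the slices of N in R.  Elimination in each
    class makes D a product of transformations (i).  The span of the P^[l,r] is
    filtered by the length of the words P, so 1 + N is a product of
    transformations (ii).  The converse part reduces to the direct one, because the
    bases of E_a R E_b and E_a M E_b generate Gamma and M. *)

From Stdlib Require Import Classical Relations.Relation_Operators.
Require Import Defs.
From HB Require Import structures.
From mathcomp Require Import all_boot all_order all_algebra.
From mathcomp Require Import perm.
Set Implicit Arguments. Unset Strict Implicit. Unset Printing Implicit Defensive.
Import Order.TTheory GRing.Theory Num.Theory.
Local Open Scope ring_scope.

(** * Spans and annihilators *)

Section Spans.
Variables (k : fieldType) (m : nat).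
Implicit Types (W S : 'M[k]_m -> Prop) (X Y : 'M[k]_m).

Lemma subspaceN S X : subspace S -> S X -> S (- X).
Proof. by move=> [_ [_ SZ]] SX; rewrite -scaleN1r; apply: SZ. Qed.

Lemma subspaceB S X Y : subspace S -> S X -> S Y -> S (X - Y).
Proof. by move=> subS SX SY; apply: subS.2.1 => //; apply: subspaceN. Qed.

Lemma subspace_sum S (I : Type) (r : seq I) (P : pred I) F :
  subspace S -> (forall i, P i -> S (F i)) -> S (\sum_(i <- r | P i) F i).
Proof. by move=> [S0 [SD _]] SF; apply: big_ind. Qed.

Lemma inSpan_subspace W : subspace (inSpan W).
Proof.
split; last split.
- by exists [::]; rewrite big_nil.
- move=> _ _ [s1 [W1 ->]] [s2 [W2 ->]]; exists (s1 ++ s2); rewrite big_cat /=.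
  by split=> // x; rewrite mem_cat => /orP[/W1|/W2].
- move=> c _ [s [Ws ->]]; exists [seq (c * x.1, x.2) | x <- s]; split.
    by move=> _ /mapP[x sx ->]; apply: (Ws x).
  by rewrite big_map scaler_sumr; apply: eq_bigr => x _; rewrite scalerA.
Qed.

Lemma inSpan_gen W X : W X -> inSpan W X.
Proof.
move=> WX; exists [:: (1, X)]; rewrite big_seq1 scale1r.
by split=> // x; rewrite inE => /eqP ->.
Qed.

Lemma inSpan_min W S X :
  subspace S -> (forall Y, W Y -> S Y) -> inSpan W X -> S X.
Proof.
move=> subS WS [s [Ws ->]]; rewrite big_seq; apply: subspace_sum => // x sx.
by apply: subS.2.2; apply/WS/Ws.
Qed.

Lemma inSpan_sub W W' X :
  (forall Y, W Y -> inSpan W' Y) -> inSpan W X -> inSpan W' X.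
Proof. exact: inSpan_min (inSpan_subspace W'). Qed.

(** The trace of X^T Y; a linear equation with coefficient matrix [D] reads [mxdot D X = 0]. *)
Definition mxdot X Y : k := \sum_i \sum_j X i j * Y i j.

(** A row space inside [S] that misses an element of [S] can be enlarged by it, and the rank is at
    most m * m. The case split is classical, [S] being an arbitrary predicate. *)
Lemma subspace_rowspace S : subspace S ->
  exists A : 'M[k]_(m * m), forall X, S X <-> (mxvec X <= A)%MS.
Proof.
move=> subS.
have: exists A : 'M[k]_(m * m), forall X, (mxvec X <= A)%MS -> S X.
  exists 0 => X; rewrite submx0 => /eqP X0.
  by rewrite -(mxvecK X) X0 linear0; apply: subS.1.
case=> A; have [d] := ubnP (m * m - \rank A)%N.
elim: d A => // d IHd A ltAd AS.
have [SA|nSA] := classic (forall X, S X -> (mxvec X <= A)%MS).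
  by exists A => X; split; [apply: SA | apply: AS].
have [X nX] := not_all_ex_not _ _ nSA; have [SX nAX] := imply_to_and _ _ nX.
apply: (IHd (A + mxvec X)%MS) => [|Y /sub_addsmxP[[u v] /= Yuv]].
  rewrite ltnS in ltAd; apply: leq_trans ltAd.
  have ltAX: (A < A + mxvec X)%MS.
    rewrite /ltmx addsmxSl /=; apply/negP => /(submx_trans (addsmxSr _ _)).
    exact: nAX.
  rewrite ltn_sub2l ?(rank_ltmx ltAX) //.
  exact: leq_trans (rank_ltmx ltAX) (rank_leq_row _).
rewrite -(mxvecK Y) Yuv linearD /=; apply: subS.2.1.
  by apply: AS; rewrite vec_mxK submxMl.
have -> : v *m mxvec X = v 0 0 *: mxvec X.
  by apply/rowP=> j; rewrite !mxE big_ord1.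
by rewrite linearZ /= mxvecK; apply: subS.2.2.
Qed.

(** The equations are the columns of the cokernel of that row space, reshaped into square
    matrices. *)
Lemma subspace_annihilator S : subspace S ->
  exists Ds : seq 'M[k]_m, forall X, S X <-> forall D, D \in Ds -> mxdot D X = 0.
Proof.
move=> /subspace_rowspace[A SA].
pose D j := vec_mx (col j (cokermx A))^T.
have dotD j X : mxdot (D j) X = (mxvec X *m cokermx A) 0 j.
  rewrite mxE (reindex _ (curry_mxvec_bij m m)) /=.
  rewrite /mxdot pair_bigA; apply: eq_bigr => -[a b] _ /=.
  by rewrite mxvecE !mxE mulrC.
exists (codom D) => X; rewrite SA submxE; split=> [/eqP X0 _ /codomP[j ->]|X0].
  by rewrite dotD X0 mxE.
by apply/eqP/rowP => j; rewrite -dotD X0 ?codom_f // mxE.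
Qed.

End Spans.

Lemma inSpan_lin (k : fieldType) m p (W : 'M[k]_m -> Prop)
    (W' : 'M[k]_p -> Prop) (f : {linear 'M[k]_m -> 'M[k]_p}) X :
  (forall Y, W Y -> inSpan W' (f Y)) -> inSpan W X -> inSpan W' (f X).
Proof.
have [W0 [WD WZ]] := inSpan_subspace W'.
move=> Wf; apply: (inSpan_min (S := fun X => inSpan W' (f X))) => //.
split; first by rewrite linear0.
by split=> [Y Z SY SZ|c Y SY]; rewrite ?linearD ?linearZ /=; auto.
Qed.

(* Cayley-Hamilton: the inverse is a polynomial in the matrix. *)
Lemma subalgebra_invmx (k : fieldType) m (A : 'M[k]_m -> Prop) X :
  subalgebra A -> A X -> X \in unitmx -> A (invmx X).
Proof.
case: m A X => [|m] A X [subA [A1 AM]] AX uX.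
  by rewrite [invmx X]flatmx0 -[0](flatmx0 1%:M).
have Ahorner p : A (horner_mx X p).
  elim/poly_ind: p => [|p c IHp]; first by rewrite rmorph0; apply: subA.1.
  rewrite rmorphD rmorphM /= horner_mx_X horner_mx_C; apply: subA.2.1.
    exact: AM.
  by rewrite -scalemx1; apply: subA.2.2.
(* The constant coefficient is the determinant up to sign, hence invertible. *)
have [q Dp] : exists q, char_poly X = q * 'X + ((char_poly X)`_0)%:P.
  exists (drop_poly 1 (char_poly X)); rewrite -['X]expr1.
  rewrite -[LHS](poly_take_drop 1) addrC; congr (_ + _).
  by apply/polyP=> -[|i]; rewrite coef_take_poly coefC.
have := Cayley_Hamilton X.
rewrite Dp rmorphD rmorphM /= horner_mx_X horner_mx_C => CH.
have p0 : (char_poly X)`_0 != 0.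
  by rewrite char_poly_det mulf_neq0 ?signr_eq0 // -unitfE.
rewrite -(mulr1 (invmx X)).
have -> : 1 = - ((char_poly X)`_0)^-1 *: (horner_mx X q * X).
  by rewrite scaleNr -scalerN (addr0_eq CH) scale_scalar_mx mulVf.
rewrite -scalerAr (_ : invmx X * _ = horner_mx X q) //; first exact: subA.2.2.
have comX : horner_mx X q * X = X * horner_mx X q.
  by rewrite -{2 3}[X]horner_mx_X -!rmorphM mulrC.
by rewrite comX mulrA -[invmx X * X]/(invmx X *m X) mulVmx // mul1r.
Qed.

(** * Generation of invertible matrices *)

Section Filtration.
Variables (k : fieldType) (m N : nat) (B : nat -> 'M[k]_m -> Prop).
Hypotheses (Bdec : forall i Z, B i.+1 Z -> B i Z)
  (BM : forall i j Y Z, B i Y -> B j Z -> B (i + j)%N (Y *m Z))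
  (BN : forall i Z, (N <= i)%N -> B i Z -> Z = 0).

Lemma mul_conj_unipotent a (b : 'M[k]_m) :
  (1%:M - a *: b) *m (1%:M + a *: b) = 1%:M + (- (a * a)) *: (b *m b).
Proof.
rewrite mulmxDl mul1mx mulNmx mulmxDr mulmx1 -scalemxAl -scalemxAr scalerA.
by rewrite opprD addrA addrK scaleNr.
Qed.

(** Multiplying by 1 - a b leaves 1 - a^2 b^2 with b^2 in layer 2i + 2, strictly deeper; the
    induction is on the distance to the vanishing layer N. *)
Lemma filtered_unitmx i a b : B i.+1 b -> 1%:M + a *: b \in unitmx.
Proof.
have [d] := ubnP (N - i)%N; elim: d i a b => // d IHd i a b /ltnSE led Bb.
have [leNi|ltiN] := leqP N i.
  by rewrite (BN _ Bb) ?scaler0 ?addr0 ?unitmx1 // ltnW.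
have: (1%:M - a *: b) *m (1%:M + a *: b) \in unitmx.
  rewrite mul_conj_unipotent; apply: (IHd (i + i.+1)%N) => //; last exact: (BM Bb Bb).
  by apply: leq_trans led; rewrite ltn_sub2l // addnS ltnS leq_addr.
by rewrite unitmx_mul => /andP[].
Qed.

Variable H : 'M[k]_m -> Prop.
Hypothesis HB : forall a b S, B 1 b -> H S -> H ((1%:M + a *: b) *m S).

Lemma filtered_dec i Z : B i.+1 Z -> B 1 Z.
Proof. by elim: i => // i IHi /Bdec. Qed.

(** [H] is assumed closed under the factors 1 + a b, not under their inverses. Multiplying by 1 - a
    b replaces the factor by 1 - a^2 b^2 from a deeper layer, until it becomes 1. *)
Lemma filtered_cancel i a b S :
  B i.+1 b -> H ((1%:M + a *: b) *m S) -> H S.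
Proof.
have [d] := ubnP (N - i)%N; elim: d i a b => // d IHd i a b /ltnSE led Bb.
have [leNi|ltiN] := leqP N i.
  by rewrite (BN _ Bb) ?scaler0 ?addr0 ?mul1mx // ltnW.
move/(HB (- a) (filtered_dec Bb)); rewrite scaleNr mulmxA mul_conj_unipotent.
apply: (IHd (i + i.+1)%N); last exact: (BM Bb Bb).
by apply: leq_trans led; rewrite ltn_sub2l // addnS ltnS leq_addr.
Qed.

Lemma inSpan_filtered_mul i j b Z :
  B i b -> inSpan (B j) Z -> inSpan (B (i + j)) (b *m Z).
Proof.
move=> Bb; apply: (inSpan_lin (f := mulmx b)) => Y BY.
exact/inSpan_gen/BM.
Qed.

(* Dividing 1 + x by one factor 1 + c b at a time only perturbs the remainder
   in the next layer of the filtration. *)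
Lemma filtered_generate x S : inSpan (B 1) x -> H S -> H ((1%:M + x) *m S).
Proof.
suff gen d i : (N - i < d)%N -> forall x S,
    inSpan (B i.+1) x -> H S -> H ((1%:M + x) *m S) by apply: (gen N.+1 0%N); rewrite ltnS leq_subr.
elim: d i => // d IHd i /ltnSE led {}x {}S.
have [leNi|ltiN] := leqP N i.
  move=> Bx; suff ->: x = 0 by rewrite addr0 mul1mx.
  apply: (inSpan_min (S := fun x => x = 0)) Bx => [|Y]; last first.
    by apply: BN; apply: leqW.
  split=> //; split=> [X Y -> ->|c X ->]; by rewrite ?addr0 ?scaler0.
case=> s [Bs ->] HS; set z := \sum_(_ <- _) _.
suff: forall y, inSpan (B i.+2) y -> H ((1%:M + (z + y)) *m S).
  by move=> /(_ 0); rewrite addr0; apply; apply: (inSpan_subspace _).1.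
rewrite {}/z; elim: s Bs => [|[c b] s IHs] Bs y By.
  (* The current layer is exhausted; only a remainder one layer deeper is left. *)
  rewrite big_nil add0r. apply: (IHd i.+1) => //.
  by apply: leq_trans led; rewrite ltn_sub2l.
have Bb : B i.+1 b by apply: (Bs (c, b)); rewrite mem_head.
have {}Bs z : z \in s -> B i.+1 z.2 by move=> sz; apply: Bs; rewrite inE sz orbT.
set x1 := \sum_(_ <- _) _; have Bx : inSpan (B i.+1) (x1 + y).
  apply: (inSpan_subspace _).2.1.
    by exists ((c, b) :: s); split=> // z; rewrite inE => /predU1P[->|/Bs].
  by apply: inSpan_sub By => Y BY; apply/inSpan_gen/Bdec.
(* The factor 1 - c b removes the leading term c b; the error c b (x1 + y) that it creates lies in
   the next layer, since b is in layer 1. *)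
apply: (@filtered_cancel i (- c) b) => //; rewrite mulmxA.
have -> : (1%:M + - c *: b) *m (1%:M + (x1 + y)) =
    1%:M + (\sum_(z <- s) z.1 *: z.2 + (y - c *: (b *m (x1 + y)))).
  rewrite mulmxDl mul1mx scaleNr mulNmx -scalemxAl mulmxDr mulmx1 scalerDr opprD.
  move: (c *: (b *m _)) => w; rewrite /x1 big_cons /= !addrA; congr (_ - w).
  by rewrite -!addrA [c *: b + _]addrC -!addrA addNr addr0.
apply: IHs => //; apply: subspaceB => //; first exact: inSpan_subspace.
apply: (inSpan_subspace _).2.2; rewrite -[i.+2]add1n.
exact: inSpan_filtered_mul (filtered_dec Bb) Bx.
Qed.

End Filtration.

(** * Factorisation of invertible matrices into elementary ones *)

Section Elementary.
Variables (k : fieldType) (m : nat) (H : 'M[k]_m -> Prop).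
Hypothesis HE : forall E S, elementary E -> H S -> H (E *m S).

Lemma perm_mx_generate (s : 'S_m) S : H S -> H (perm_mx s *m S).
Proof.
have [ts -> _] := prod_tpermP s; elim: ts => [|[u v] ts IHts] HS.
  by rewrite big_nil perm_mx1 mul1mx.
rewrite big_cons perm_mxM -mulmxA; apply: HE; last exact: IHts.
by left; exists u, v.
Qed.

Lemma diag_mx_generate (d : 'rV[k]_m) S :
  (forall i, d 0 i != 0) -> H S -> H (diag_mx d *m S).
Proof.
move=> nzd HS.
(* The entries of [d] are switched on one at a time along a list; all others are kept at 1. *)
have -> : d = \row_j (if j \in enum 'I_m then d 0 j else 1).
  by apply/rowP=> j; rewrite mxE mem_enum.
elim: (enum _) => [|u s IHs].
  rewrite (_ : diag_mx _ = 1%:M) ?mul1mx // -diag_const_mx; congr diag_mx.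
  by apply/rowP=> j; rewrite !mxE.
have [su|nsu] := boolP (u \in s).
  rewrite (_ : \row_j _ = \row_j if j \in s then d 0 j else 1) //.
  apply/rowP=> j; rewrite !mxE inE; case: eqP => // ->; by rewrite su.
set E : 'M[k]_m :=
  \matrix_(a, b) (if a == b then (if a == u then d 0 u else 1) else 0).
have DE : E = diag_mx (\row_j if j == u then d 0 u else 1).
  by apply/matrixP=> a b; rewrite !mxE mulrb.
rewrite (_ : diag_mx _ = E *m diag_mx (\row_j if j \in s then d 0 j else 1)).
  rewrite -mulmxA; apply: HE IHs; right; left.
  by exists u, (d 0 u).
rewrite DE mulmx_diag; congr diag_mx; apply/rowP=> j; rewrite !mxE inE.
by case: eqP => [->|] /=; rewrite ?(negPf nsu) ?mulr1 ?mul1r.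
Qed.

(** The weight [f] lets one argument serve lower and upper unitriangular matrices: a matrix unit at
    (u, v) lies in layer i when f v is at least f u + i. *)
Lemma unitriangular_generate (f : 'I_m -> nat) (x : 'M[k]_m) S :
  (forall u v, (f v <= f u)%N -> x u v = 0) -> H S -> H ((1%:M + x) *m S).
Proof.
move=> x0 HS; pose N := (\max_u f u).+1.
pose B i (Z : 'M[k]_m) := Z = 0 \/ exists u v, (f u + i <= f v)%N /\ Z = delta_mx u v.
apply: (@filtered_generate k m N B) HS.
- move=> i Z [->|[u [v [le ->]]]]; first by left.
  by right; exists u, v; split=> //; apply: leq_trans le; rewrite leq_add2l.
- move=> i j Y Z [->|[u [v [le1 ->]]]]; first by left; rewrite mul0mx.
  case=> [->|[u' [v' [le2 ->]]]]; first by left; rewrite mulmx0.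
  have [Euv|nuv] := eqVneq v u'; last by left; rewrite mul_delta_mx_0.
  right; exists u, v'; split; last by rewrite Euv mul_delta_mx.
  by rewrite addnA; apply: leq_trans le2; rewrite leq_add2r -Euv.
- move=> i Z leNi [//|[u [v [le _]]]].
  have := leq_trans (leq_addl _ _) le; rewrite leqNgt.
  by rewrite (leq_trans _ leNi) // ltnS leq_bigmax.
- move=> a b S' [->|[u [v [le ->]]]] HS'; first by rewrite scaler0 addr0 mul1mx.
  apply: HE HS'; right; right; exists u, v, a; split=> //.
  by apply: contraTneq le => ->; rewrite addn1 ltnn.
rewrite (matrix_sum_delta x); have spanB := inSpan_subspace (B 1%N).
apply: subspace_sum => // u _; apply: subspace_sum => // v _.
have [lt|/x0->] := ltnP (f u) (f v); last by rewrite scale0r; exact: spanB.1.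
apply/spanB.2.2/inSpan_gen; right; exists u, v.
by rewrite addn1.
Qed.

End Elementary.

(** The LUP decomposition writes A as a permutation times L U, and U splits further into a
    unitriangular matrix times its diagonal; each factor is covered by one of the preceding
    lemmas. *)
Lemma unitmx_generate (k : fieldType) m (H : 'M[k]_m -> Prop) A S :
  (forall E S, elementary E -> H S -> H (E *m S)) ->
  A \in unitmx -> H S -> H (A *m S).
Proof.
(* In size 0 all matrices coincide; LUP handles positive sizes. *)
case: m H A S => [|m] H A S HE uA HS; first by rewrite [_ *m _]flatmx0 -[0](flatmx0 S).
have := cormen_lup_correct A; have := cormen_lup_perm A.
have := @cormen_lup_lower _ _ A; have := @cormen_lup_upper _ _ A.
case: (cormen_lup A) => [[P L] U] /= Uu Ll /is_perm_mxP[s ->] PA.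
have Lx : L = 1%:M + (L - 1%:M) by rewrite addrC subrK.
have detL : \det L = 1.
  rewrite det_trig; first by rewrite big1 // => i _; rewrite Ll ?eqxx.
  by apply/is_trig_mxP=> i j ltij; rewrite Ll ?(ltnW ltij) // -val_eqE ltn_eqF.
(* The product of these entries is, up to sign, the determinant of A. *)
have U0 i : U i i != 0.
  have: \det U != 0.
    have : \det (perm_mx s * A) != 0.
      by rewrite -unitfE [_ \is a _]unitmx_mul unitmx_perm.
    by rewrite PA det_mulmx detL mul1r.
  rewrite -det_tr det_trig; last by apply/is_trig_mxP=> a b ltab; rewrite mxE Uu.
  by rewrite (bigD1 i) //= mxE mulf_eq0 negb_or => /andP[].
pose D := \row_i U i i; pose D' := \row_i (U i i)^-1.
have UD : U = (1%:M + (U - diag_mx D) *m diag_mx D') *m diag_mx D.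
  rewrite mulmxDl mul1mx -mulmxA mulmx_diag.
  rewrite (_ : \row__ _ = const_mx 1).
    by rewrite diag_const_mx mulmx1 addrC subrK.
  by apply/rowP=> i; rewrite !mxE mulVf.
have -> : A = perm_mx s^-1 *m (L *m U).
  by rewrite -[L *m U]PA mulmxA -perm_mxM mulVg perm_mx1 mul1mx.
rewrite -!mulmxA; apply: perm_mx_generate => //.
(* L - 1 lives below the diagonal, so the weight reverses the order of the indices. *)
rewrite {}Lx; apply: (unitriangular_generate HE (f := fun i => (m - i)%N)).
  move=> u v le; rewrite !mxE Ll ?subrr //.
  apply: contraTT le; rewrite -!ltnNge => ltvu.
  by rewrite ltn_sub2l // (leq_trans ltvu) // -ltnS.
rewrite UD -mulmxA; apply: (unitriangular_generate HE (f := val)).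
  move=> u v le; rewrite mul_mx_diag !mxE; case: (ltngtP v u) le => // [lt|/val_inj->] _.
    by rewrite (Uu u v lt) -val_eqE gtn_eqF // subr0 mul0r.
  by rewrite eqxx subrr mul0r.
by apply: diag_mx_generate => // i; rewrite mxE.
Qed.

(** * Slices of block matrices *)

Section NthMx.
Variables (k : fieldType).

Lemma nth_mxE m p (A : 'M[k]_(m, p)) (a : 'I_m) (b : 'I_p) : nth_mx A a b = A a b.
Proof. by rewrite /nth_mx !valK. Qed.

Lemma nth_mx_out m p (A : 'M[k]_(m, p)) a b :
  ~~ ((a < m) && (b < p))%N -> nth_mx A a b = 0.
Proof.
rewrite /nth_mx negb_and => /orP[] lt; last first.
  by rewrite [insub b]insubN //; case: insub.
by rewrite insubN.
Qed.

Lemma nth_mx_eq m p (A B : 'M[k]_(m, p)) :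
  (forall a b, nth_mx A a b = nth_mx B a b) -> A = B.
Proof. by move=> eqAB; apply/matrixP=> a b; rewrite -!nth_mxE. Qed.

Lemma nth_mxP c m p (A B : 'M[k]_(m, p)) a b :
  nth_mx (c *: A + B) a b = c * nth_mx A a b + nth_mx B a b.
Proof.
rewrite /nth_mx; case: insub => [i|]; last by rewrite mulr0 addr0.
by case: insub => [j|]; rewrite ?mulr0 ?addr0 // !mxE.
Qed.

Lemma nth_mx0 m p a b : nth_mx (0 : 'M[k]_(m, p)) a b = 0.
Proof. by rewrite /nth_mx; do 2!case: insub => // ?; rewrite mxE. Qed.

Lemma nth_mxZ c m p (A : 'M[k]_(m, p)) a b : nth_mx (c *: A) a b = c * nth_mx A a b.
Proof. by rewrite -[c *: A]addr0 nth_mxP nth_mx0 addr0. Qed.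

Lemma nth_mx_sum (I : Type) (r : seq I) m p (F : I -> 'M[k]_(m, p)) a b :
  nth_mx (\sum_(i <- r) F i) a b = \sum_(i <- r) nth_mx (F i) a b.
Proof.
elim: r => [|i r IHr]; first by rewrite !big_nil nth_mx0.
by rewrite !big_cons -IHr -[X in X + _]scale1r nth_mxP mul1r.
Qed.

Lemma nth_mx_matrix m p (F : 'I_m -> 'I_p -> k) (f : nat -> nat -> k) a b :
  (forall a b, F a b = f a b) ->
  nth_mx (\matrix_(a, b) F a b) a b = if ((a < m) && (b < p))%N then f a b else 0.
Proof.
move=> Ff; case: ifP => [/andP[lta ltb]|/negbT]; last exact: nth_mx_out.
by rewrite (nth_mxE _ (Ordinal lta) (Ordinal ltb)) mxE Ff.
Qed.

(** Entries beyond the sizes read as 0, so the inner sum may run to any bound N at least p; blocks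
    of different sizes then share one index range. *)
Lemma nth_mxM N m p q (A : 'M[k]_(m, p)) (B : 'M[k]_(p, q)) a b : (p <= N)%N ->
  nth_mx (A *m B) a b = \sum_(c < N) nth_mx A a c * nth_mx B c b.
Proof.
move=> lepN; have [/andP[lta ltb]|nab] := boolP ((a < m) && (b < q))%N; last first.
  rewrite nth_mx_out // big1 // => c _; move: nab; rewrite negb_and.
  case/orP=> /negPf nlt; first by rewrite (nth_mx_out A) ?mul0r ?nlt.
  by rewrite (nth_mx_out B) ?mulr0 ?nlt ?andbF.
rewrite (nth_mxE _ (Ordinal lta) (Ordinal ltb)) mxE.
under eq_bigr do rewrite -!nth_mxE /=.
rewrite (big_ord_widen N (fun c => nth_mx A a c * nth_mx B c b)) // big_mkcond.
apply: eq_bigr => c _; case: ifP => // ltc.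
by rewrite nth_mx_out ?mul0r // ltc andbF.
Qed.

End NthMx.

(** * Slicing and the matrices A^[l,r] *)

Section Slices.
Variables (k : fieldType) (t : nat) (n : 'I_t -> nat).
Implicit Types (S T : 'M[k]_(bsz n)) (A : 'M[k]_t).
Local Notation N := (\max_i n i).

Definition slice (a b : nat) S : 'M[k]_t := \matrix_(i, j) bent S i j a b.

Lemma slice_linear a b : linear (slice a b).
Proof.
move=> c S T; apply/matrixP=> i j; rewrite !mxE /bent.
have -> : submxblock (c *: S + T) i j = c *: submxblock S i j + submxblock T i j.
  by apply/matrixP=> u v; rewrite !mxE.
by rewrite nth_mxP.
Qed.

HB.instance Definition _ a b :=
  GRing.isLinear.Build k 'M[k]_(bsz n) 'M[k]_t _ (slice a b) (@slice_linear a b).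

Lemma slice_inj S T : (forall a b, slice a b S = slice a b T) -> S = T.
Proof.
move=> eqST; apply/mxblockP=> i j; apply: nth_mx_eq => a b.
by move/matrixP: (eqST a b) => /(_ i j); rewrite !mxE.
Qed.

(** Padding all blocks with zeros to the common size N turns block multiplication into that of N x N
    matrices over k^(t x t). *)
Lemma sliceM S T a b :
  slice a b (S *m T) = \sum_(c < N) slice a c S *m slice c b T.
Proof.
apply/matrixP=> i j; rewrite mxE /bent summxE.
have -> : submxblock (S *m T) i j = \sum_l submxblock S i l *m submxblock T l j.
  by rewrite -{1}(submxblockK S) -{1}(submxblockK T) mul_mxblock mxblockK.
rewrite nth_mx_sum.
transitivity (\sum_l \sum_(c < N) bent S i l a c * bent T l j c b).
  by apply: eq_bigr => l _; apply: nth_mxM; apply: leq_bigmax.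
rewrite exchange_big; apply: eq_bigr => c _; rewrite mxE.
by apply: eq_bigr => l _; rewrite !mxE.
Qed.

Lemma slice_out S a b i j :
  ~~ ((a < n i) && (b < n j))%N -> slice a b S i j = 0.
Proof. by move=> nab; rewrite mxE /bent nth_mx_out. Qed.

(** The bound on [a] comes from the padding: block i carries only n_i diagonal ones. *)
Lemma slice1 a b i j :
  slice a b 1%:M i j = ((i == j) && (a == b) && (a < n i)%N)%:R.
Proof.
rewrite mxE /bent -mxdiagZ /mxdiag mxblockK.
have [<-|nij] := eqVneq i j; last by rewrite nth_mx0.
rewrite conform_mx_id; have [/andP[lta ltb]|nab] := boolP ((a < n i) && (b < n i))%N.
  by rewrite (nth_mxE _ (Ordinal lta) (Ordinal ltb)) mxE -val_eqE /= lta andbT.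
rewrite nth_mx_out //; move: nab; have [->|_] //= := eqVneq a b.
by rewrite andbb => /negPf->.
Qed.

Lemma slice_mx_lr A l r a b i j : slice a b (mx_lr n A l r) i j =
  if [&& a == l, b == r, (l < n i)%N & (r < n j)%N] then A i j else 0.
Proof.
rewrite mxE /bent mxblockK nth_mxZ.
rewrite (nth_mx_matrix (f := fun a b => ((a == l) && (b == r))%:R)) //.
have [->|_] := eqVneq a l; last by case: ifP; rewrite mulr0.
have [->|_] := eqVneq b r; last by case: ifP; rewrite mulr0.
by case: ifP => _ /=; rewrite ?mulr1 ?mulr0.
Qed.

Variable eqv : rel 'I_t.
Hypothesis step : step_seq eqv n.

(** The sizes n_i are constant on each of the two classes linked by A, so the bounds given by
    validity hold at every nonzero entry and none is cut off. *)
Lemma slice_mx_lr_valid A l r a b : valid_lr eqv n A l r ->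
  slice a b (mx_lr n A l r) = if (a == l) && (b == r) then A else 0.
Proof.
case=> i0 [j0 [lA ltl ltr]]; apply/matrixP=> i j; rewrite slice_mx_lr.
case: eqP => _ /=; last by rewrite mxE.
case: eqP => _ /=; last by rewrite mxE.
have [->|/lA/andP[/step<- /step<-]] := eqVneq (A i j) 0; first by case: ifP.
by rewrite ltl ltr.
Qed.

(** A nonzero entry surviving at (l, r) would itself witness validity. This covers the positions
    below N that are out of range for A. *)
Lemma mx_lr_invalid A l r :
  links_some eqv A -> ~ valid_lr eqv n A l r -> mx_lr n A l r = 0.
Proof.
case=> i0 [j0 lA] nval; apply: slice_inj => a b; rewrite linear0.
apply/matrixP=> i j; rewrite slice_mx_lr mxE; case: ifP => // /and4P[_ _ ltl ltr].
have [//|/lA/andP[/step ei /step ej]] := eqVneq (A i j) 0.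
by case: nval; exists i0, j0; rewrite ei ej.
Qed.

Lemma slice_Sdiag i0 (E : 'M[k]_(n i0)) a b i j : slice a b (Sdiag eqv E) i j =
  if i == j then (if eqv i0 i then nth_mx E a b else ((a == b) && (a < n i)%N)%:R)
  else 0.
Proof.
rewrite mxE /bent mxblockK; have [<-|nij] := eqVneq i j; last by rewrite nth_mx0.
rewrite conform_mx_id.
rewrite (nth_mx_matrix (f := fun a b => if eqv i0 i then nth_mx E a b else (a == b)%:R)) //.
have [/step en|_] := boolP (eqv i0 i).
  by case: ifP => // /negbT; rewrite -en => /nth_mx_out->.
by have [->|_] /= := eqVneq a b; rewrite ?andbb; case: ifP.
Qed.

Lemma mx_lrP c A B l r : mx_lr n (c *: A + B) l r = c *: mx_lr n A l r + mx_lr n B l r.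
Proof.
apply: slice_inj => a b; rewrite linearP; apply/matrixP=> i j.
by rewrite [RHS]mxE [(c *: slice _ _ _) _ _]mxE !slice_mx_lr !mxE; case: ifP; rewrite ?mulr0 ?addr0.
Qed.

Lemma mx_lr0 l r : mx_lr n (0 : 'M[k]_t) l r = 0.
Proof.
apply: (addIr (mx_lr n (0 : 'M[k]_t) l r)).
by rewrite -{1}[X in X + _]scale1r -mx_lrP scaler0 !add0r.
Qed.

Lemma mx_lrZ c A l r : mx_lr n (c *: A) l r = c *: mx_lr n A l r.
Proof. by rewrite -[c *: A]addr0 mx_lrP mx_lr0 addr0. Qed.

Lemma mx_lrD A B l r : mx_lr n (A + B) l r = mx_lr n A l r + mx_lr n B l r.
Proof. by rewrite -[X in X + B]scale1r mx_lrP scale1r. Qed.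

Lemma mx_lr_sum S : S = \sum_(a < N) \sum_(b < N) mx_lr n (slice a b S) a b.
Proof.
apply: slice_inj => a b; apply/matrixP=> i j; rewrite linear_sum summxE.
have [/andP[lta ltb]|nab] := boolP ((a < n i) && (b < n j))%N; last first.
  rewrite slice_out // big1 // => u _; rewrite linear_sum summxE big1 // => v _.
  by rewrite slice_out.
have ltN i1 c : (c < n i1)%N -> (c < N)%N by move/leq_trans; apply; apply: leq_bigmax.
rewrite (bigD1 (Ordinal (ltN i a lta))) //= [X in _ + X]big1 ?addr0 => [|u nu].
  rewrite linear_sum summxE (bigD1 (Ordinal (ltN j b ltb))) //= [X in _ + X]big1 ?addr0.
    by rewrite slice_mx_lr !eqxx lta ltb.
  by move=> v nv; rewrite slice_mx_lr [b == v]eq_sym [v == b :> nat](negPf nv) andbF.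
rewrite linear_sum summxE big1 // => v _.
by rewrite slice_mx_lr [a == u]eq_sym [u == a :> nat](negPf nu).
Qed.

(** Slicing sends a generator V^[l,r] to V or 0. Conversely, S is the sum of its slices put back in
    place, and placing at a fixed position is linear, sending V to a generator or to 0. *)
Lemma inSpan_slice (W : 'M[k]_t -> Prop) S :
  (forall V, W V -> links_some eqv V) ->
  inSpan (fun Z => exists V l r,
    [/\ W V, V != 0, valid_lr eqv n V l r & Z = mx_lr n V l r]) S <->
  (forall a b, inSpan W (slice a b S)).
Proof.
move=> linkW; set W' := fun Z => _; split=> [W'S a b|WS].
  apply: (inSpan_lin (f := slice a b)) W'S => _ [V [l [r [WV _ val ->]]]].
  rewrite /= slice_mx_lr_valid //.
  by case: ifP => _; [apply: inSpan_gen | apply: (inSpan_subspace _).1].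
have [W0 [WD WZ]] := inSpan_subspace W'.
rewrite [S]mx_lr_sum; apply: subspace_sum => // a _; apply: subspace_sum => // b _.
apply: (inSpan_min (S := fun A => inSpan W' (mx_lr n A a b))) (WS a b) => [|V WV].
  split; first by rewrite mx_lr0.
  split=> [A B SA SB|c A SA]; first by rewrite mx_lrD; apply: WD.
  by rewrite mx_lrZ; apply: WZ.
have [->|nzV] := eqVneq V 0; first by rewrite mx_lr0.
have [val|nval] := classic (valid_lr eqv n V a b); last by rewrite mx_lr_invalid //; apply: linkW.
by apply: inSpan_gen; exists V, a, b.
Qed.

End Slices.

(** * Matrices linking classes *)

Section Classes.
Variables (k : fieldType) (t : nat) (eqv : rel 'I_t).
Hypothesis eqvE : equivalence_rel eqv.
Implicit Types (X Y : 'M[k]_t) (d : 'rV[k]_t).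
Local Notation E := (Ecls k eqv).

Lemma eqv_refl i : eqv i i. Proof. exact: (eqvE i i i).1. Qed.
Lemma eqv_left i j l : eqv i j -> eqv i l = eqv j l. Proof. exact: (eqvE i j l).2. Qed.
Lemma eqv_sym i j : eqv i j = eqv j i.
Proof. by apply/idP/idP=> e; rewrite -(eqv_left _ e) eqv_refl. Qed.

Definition class_const d := forall i j, eqv i j -> d 0 i = d 0 j.

(** Equivalent indices define the same predicate, so [pick] returns the same index for both; by
    reflexivity the default is never taken. *)
Definition class_rep i := odflt i [pick j | eqv i j].

Lemma eqv_rep i : eqv i (class_rep i).
Proof. by rewrite /class_rep; case: pickP => //= _; apply: eqv_refl. Qed.

Lemma rep_eqv i j : eqv i j -> class_rep i = class_rep j.
Proof.
move=> eij; rewrite /class_rep (eq_pick (fun l => eqv_left l eij)).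
by case: pickP => //= /(_ j); rewrite eqv_refl.
Qed.

Lemma rep_idem i : class_rep (class_rep i) = class_rep i.
Proof. by rewrite -(rep_eqv (eqv_rep i)). Qed.

Lemma Ecls_diag a : E a = diag_mx (\row_j (eqv a j)%:R).
Proof. by apply/matrixP=> i j; rewrite !mxE; case: (i == j). Qed.

Lemma Ecls_eqv a b : eqv a b -> E a = E b.
Proof. by move=> eab; apply/matrixP=> i j; rewrite !mxE (eqv_left i eab). Qed.

Lemma mul_Ecls a X i j : (E a *m X) i j = if eqv a i then X i j else 0.
Proof. by rewrite Ecls_diag mul_diag_mx !mxE; case: eqv; rewrite ?mul1r ?mul0r. Qed.

Lemma mulEcls a X i j : (X *m E a) i j = if eqv a j then X i j else 0.
Proof. by rewrite Ecls_diag mul_mx_diag !mxE; case: eqv; rewrite ?mulr1 ?mulr0. Qed.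

Lemma mul_EclsEcls a b X i j :
  (E a *m X *m E b) i j = if eqv a i && eqv b j then X i j else 0.
Proof. by rewrite mulEcls mul_Ecls; case: eqv; case: eqv. Qed.

Lemma sum_Ecls d : class_const d ->
  diag_mx d = \sum_(a | class_rep a == a) d 0 a *: E a.
Proof.
move=> cd; apply/matrixP=> i j; rewrite summxE (bigD1 (class_rep i)) ?rep_idem //=.
rewrite big1 ?addr0 => [|a /andP[/eqP ra na]].
  rewrite !mxE eqv_sym eqv_rep andbT -(cd _ _ (eqv_rep i)).
  by case: (i == j); rewrite ?mulr1 ?mulr0.
rewrite !mxE; case: eqP => _ /=; last by rewrite mulr0.
have [/rep_eqv eai|] := boolP (eqv a i); last by rewrite mulr0.
by rewrite -eai ra eqxx in na.
Qed.

Lemma sum_Ecls1 : 1%:M = \sum_(a | class_rep a == a) E a.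
Proof.
rewrite -diag_const_mx sum_Ecls => [|i j _]; last by rewrite !mxE.
by apply: eq_bigr => a _; rewrite mxE scale1r.
Qed.

(** Peirce decomposition: the E_a over class representatives sum to 1, so X is the sum of its
    corners E_a X E_b. *)
Lemma subspace_homogeneous (S : 'M[k]_t -> Prop) X :
  subspace S -> (forall a b, S (E a *m X *m E b)) -> S X.
Proof.
move=> subS SX; rewrite -[X]mul1mx -[_ *m X]mulmx1 sum_Ecls1.
rewrite !mulmx_suml; apply: subspace_sum => // a _.
by rewrite mulmx_sumr; apply: subspace_sum => // b _.
Qed.

Lemma links_Ecls a b X : links eqv (E a *m X *m E b) a b.
Proof. by move=> i j; rewrite mul_EclsEcls; case: ifP => //; rewrite eqxx. Qed.

Lemma links_mulmx X Y i0 j0 i1 j1 :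
  links eqv X i0 j0 -> links eqv Y i1 j1 -> links eqv (X *m Y) i0 j1.
Proof.
move=> lX lY i j.
have link0 (Z : 'M[k]_t) u v u' v' : links eqv Z u v -> ~~ (eqv u u' && eqv v v') -> Z u' v' = 0.
  by move=> lZ; apply: contraNeq => /lZ.
apply: contraNT; rewrite negb_and mxE => /orP[] /negPf nE; rewrite big1 // => l _.
  by rewrite (link0 _ _ _ _ _ lX) ?nE ?mul0r.
by rewrite (link0 _ _ _ _ _ lY) ?nE ?andbF ?mulr0.
Qed.

Lemma links_some_mulmx X Y :
  links_some eqv X -> links_some eqv Y -> links_some eqv (X *m Y).
Proof. by case=> i0 [j0 lX] [i1 [j1 lY]]; exists i0, j1; apply: links_mulmx lX lY. Qed.

(** A linked matrix sits in a single Peirce corner. Hence spans of linked matrices are stable under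
    class-constant diagonal matrices. *)
Lemma mul_Ecls_links a X : links_some eqv X -> E a *m X = X \/ E a *m X = 0.
Proof.
case=> i0 [j0 lX]; have [eai|nai] := boolP (eqv a i0); [left | right];
  apply/matrixP=> i j; rewrite mul_Ecls ?mxE.
  have [->|/lX/andP[ei _]] := eqVneq (X i j) 0; first by case: ifP.
  by rewrite (eqv_left _ eai) ei.
have [->|/lX/andP[ei _]] := eqVneq (X i j) 0; first by case: ifP.
by rewrite eqv_sym -(eqv_left _ ei) eqv_sym (negPf nai).
Qed.

Lemma mulEcls_links a X : links_some eqv X -> X *m E a = X \/ X *m E a = 0.
Proof.
case=> i0 [j0 lX]; have [eai|nai] := boolP (eqv a j0); [left | right];
  apply/matrixP=> i j; rewrite mulEcls ?mxE.
  have [->|/lX/andP[_ ei]] := eqVneq (X i j) 0; first by case: ifP.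
  by rewrite (eqv_left _ eai) ei.
have [->|/lX/andP[_ ei]] := eqVneq (X i j) 0; first by case: ifP.
by rewrite eqv_sym -(eqv_left _ ei) eqv_sym (negPf nai).
Qed.

Section LinkedSpan.
Variable W : 'M[k]_t -> Prop.
Hypothesis linkW : forall V, W V -> links_some eqv V.

Lemma inSpan_Eclsl a X : inSpan W X -> inSpan W (E a *m X).
Proof.
apply: (inSpan_lin (f := mulmx (E a))) => V WV /=.
have [->|->] := mul_Ecls_links a (linkW WV); first exact: inSpan_gen.
exact: (inSpan_subspace _).1.
Qed.

Lemma inSpan_Eclsr a X : inSpan W X -> inSpan W (X *m E a).
Proof.
apply: (inSpan_lin (f := mulmxr (E a))) => V WV /=.
have [->|->] := mulEcls_links a (linkW WV); first exact: inSpan_gen.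
exact: (inSpan_subspace _).1.
Qed.

Lemma inSpan_diagl d X : class_const d -> inSpan W X -> inSpan W (diag_mx d *m X).
Proof.
move=> cd WX; rewrite sum_Ecls // mulmx_suml; apply: subspace_sum => [|a _].
  exact: inSpan_subspace.
by rewrite -scalemxAl; apply/(inSpan_subspace W).2.2/inSpan_Eclsl.
Qed.

Lemma inSpan_diagr d X : class_const d -> inSpan W X -> inSpan W (X *m diag_mx d).
Proof.
move=> cd WX; rewrite sum_Ecls // mulmx_sumr; apply: subspace_sum => [|a _].
  exact: inSpan_subspace.
by rewrite -scalemxAr; apply/(inSpan_subspace W).2.2/inSpan_Eclsr.
Qed.

End LinkedSpan.

(** * Linear equations split along pairs of classes *)

Lemma mxdot_Ecls a b X Y : mxdot (E a *m X *m E b) Y = mxdot X (E a *m Y *m E b).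
Proof.
apply: eq_bigr => i _; apply: eq_bigr => j _; rewrite !mul_EclsEcls.
by case: ifP; rewrite ?mulr0 ?mul0r.
Qed.

Definition Ecls_sandwiches (Ds : seq 'M[k]_t) :=
  [seq E ab.1 *m D *m E ab.2 | D <- Ds, ab <- enum {: 'I_t * 'I_t}].

Lemma Ecls_sandwichesP Ds C :
  reflect (exists D a b, D \in Ds /\ C = E a *m D *m E b) (C \in Ecls_sandwiches Ds).
Proof.
apply: (iffP allpairsP) => [[[D [a b]] /= [DDs _ ->]]|[D [a [b [DDs ->]]]]].
  by exists D, a, b.
by exists (D, (a, b)); rewrite mem_enum.
Qed.

(** Cutting out a Peirce corner is self-adjoint for [mxdot]; since [S] contains the corners of its
    elements, replacing each equation by its corners does not change the solutions. *)
Lemma homogeneous_presM (S : 'M[k]_t -> Prop) :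
  subspace S -> (forall a b X, S X -> S (E a *m X *m E b)) ->
  exists Ds, presM eqv Ds S.
Proof.
move=> subS homS; have [Ds SDs] := subspace_annihilator subS.
exists (Ecls_sandwiches Ds); split.
  by move=> C /Ecls_sandwichesP[D [a [b [_ ->]]]]; exists a, b; apply: links_Ecls.
move=> X; split=> [SX _ /Ecls_sandwichesP[D [a [b [DDs ->]]]]|X0].
  by rewrite -/(mxdot _ _) mxdot_Ecls; apply: (SDs _).1 => //; apply: homS.
apply: subspace_homogeneous => // a b; apply/SDs => D DDs.
by rewrite -mxdot_Ecls; apply: X0; apply/Ecls_sandwichesP; exists D, a, b.
Qed.

Definition strict_part X : 'M[k]_t := \matrix_(i, j) (if (i < j)%N then X i j else 0).

Lemma mxdot_strict X Y : mxdot (strict_part X) Y = mxdot X (strict_part Y).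
Proof.
apply: eq_bigr => i _; apply: eq_bigr => j _; rewrite !mxE.
by case: ifP; rewrite ?mulr0 ?mul0r.
Qed.

Lemma strict_part_Ecls a b X :
  strict_part (E a *m X *m E b) = E a *m strict_part X *m E b.
Proof.
apply/matrixP=> i j; rewrite mul_EclsEcls mxE mul_EclsEcls [strict_part X i j]mxE.
by case: (i < j)%N; case: ifP.
Qed.

Lemma upper_split S : upper_tri S -> S = diag_mx (\row_i S i i) + strict_part S.
Proof.
move=> uS; apply/matrixP=> i j; rewrite !mxE -val_eqE.
by case: ltngtP => [||/val_inj->]; rewrite ?addr0 ?add0r // => /uS.
Qed.

Lemma strict_part_split d X :
  strict_upper X -> strict_part (diag_mx d + X) = X.
Proof.
move=> sX; apply/matrixP=> i j; rewrite !mxE -val_eqE.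
by case: ltngtP => [_|/ltnW leji|/val_inj->]; rewrite ?add0r // sX.
Qed.

(** The sum of the class-constant diagonals and a strictly upper [R], phrased entrywise to match
    [presG]; [split_algP] recovers the sum. *)
Definition split_alg (R : 'M[k]_t -> Prop) S :=
  [/\ upper_tri S, (forall i j, eqv i j -> S i i = S j j) & R (strict_part S)].

Lemma split_algP (R : 'M[k]_t -> Prop) S : (forall X, R X -> strict_upper X) ->
  split_alg R S <-> exists d X, [/\ class_const d, R X & S = diag_mx d + X].
Proof.
move=> sR; split=> [[uS cS RS]|[d [X [cd RX ->]]]].
  exists (\row_i S i i), (strict_part S); split; rewrite -?upper_split //.
  by move=> i j eij; rewrite !mxE (cS i j).
have sX := sR X RX; split; last by rewrite strict_part_split.
- by move=> i j ltji; rewrite !mxE -val_eqE gtn_eqF // sX ?add0r // ltnW.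
- by move=> i j eij; rewrite !mxE !eqxx (cd i j) // !sX.
Qed.

(** As in [homogeneous_presM], with coefficients first cut to their strictly upper part:
    [strict_part] is self-adjoint too, so the equations test only the strict part of S. *)
Lemma split_alg_presG (R : 'M[k]_t -> Prop) :
  subspace R -> (forall a b X, R X -> R (E a *m X *m E b)) ->
  exists Cs, presG eqv Cs (split_alg R).
Proof.
move=> subR homR; have [Ds RDs] := subspace_annihilator subR.
exists (Ecls_sandwiches (map strict_part Ds)); split.
  move=> _ /Ecls_sandwichesP[_ [a [b [/mapP[D _ ->] ->]]]]; split.
    by move=> i j leji; rewrite mul_EclsEcls mxE ltnNge leji; case: ifP.
  by exists a, b; apply: links_Ecls.
move=> S; have DsE D a b : mxdot (E a *m strict_part D *m E b) S =
    mxdot D (E a *m strict_part S *m E b).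
  by rewrite mxdot_Ecls mxdot_strict strict_part_Ecls.
split=> [] [uS cS RS]; split=> //.
  move=> _ /Ecls_sandwichesP[_ [a [b [/mapP[D DDs ->] ->]]]].
  by rewrite -/(mxdot _ _) DsE; apply: (RDs _).1 => //; apply: homR.
apply: subspace_homogeneous => // a b; apply/RDs => D DDs; rewrite -DsE.
apply: RS; apply/Ecls_sandwichesP; exists (strict_part D), a, b.
by rewrite map_f.
Qed.

End Classes.

(** * The algebra and the bimodule of a triple *)

Section Words.
Variables (k : fieldType) (t : nat).
Implicit Types (P Q X Y V : 'M[k]_t) (Ps Vs w : seq 'M[k]_t).

Lemma foldr_mulmx_cat w w' :
  foldr mulmx 1%:M (w ++ w') = foldr mulmx 1%:M w *m foldr mulmx 1%:M w' :> 'M[k]_t.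
Proof. by elim: w => [|P w IHw] /=; rewrite ?mul1mx // IHw mulmxA. Qed.

(** The diagonal of P^m consists of the m-th powers of the diagonal entries of P, and a field has no
    nonzero nilpotents. *)
Lemma nilpotent_upper_strict P : mx_nilpotent P -> upper_tri P -> strict_upper P.
Proof.
move=> [m Pm] uP i j; rewrite leq_eqVlt => /predU1P[/val_inj->|]; last exact: uP.
suff [_ Pii]: upper_tri (iter m (mulmx P) 1%:M) /\
    iter m (mulmx P) 1%:M i i = P i i ^+ m.
  by move: Pii; rewrite Pm mxE => /esym/eqP; rewrite expf_eq0 => /andP[_ /eqP].
elim: m {Pm} => [|m [uPm Pii]] /=.
  split; last by rewrite mxE eqxx.
  by move=> u v ltvu; rewrite mxE -val_eqE gtn_eqF.
split=> [u v ltvu|]; rewrite mxE.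
  rewrite big1 // => l _; case: (ltnP l u) => [/uP->|leul]; first by rewrite mul0r.
  by rewrite uPm ?mulr0 // (leq_trans ltvu).
rewrite (bigD1 i) //= Pii -exprS big1 ?addr0 // => l nli.
case: (ltngtP l i) nli => [/uP->|/uPm->|/val_inj->]; rewrite ?mul0r ?mulr0 //.
by rewrite eqxx.
Qed.

Lemma nilpotent_strict P : strict_upper P -> mx_nilpotent P.
Proof.
move=> sP; exists t; apply/matrixP=> i j; rewrite mxE.
(* Each factor pushes the support one diagonal further up, so t factors leave nothing. *)
suff gen m : forall i j : 'I_t, (j < i + m)%N -> iter m (mulmx P) 1%:M i j = 0.
  by apply: gen; rewrite ltn_addl.
elim: m => [|m IHm] u v /=; first by rewrite addn0 mxE -val_eqE => /gtn_eqF->.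
move=> ltv; rewrite mxE big1 // => l _; case: (leqP l u) => [/sP->|ltul].
  by rewrite mul0r.
by rewrite IHm ?mulr0 // (leq_trans ltv) // -addSnnS leq_add2r.
Qed.

(** The length is bounded below rather than fixed, so that these sets decrease with m and form a
    multiplicative filtration. *)
Definition isWord Ps m P := exists w,
  [/\ (m <= size w)%N, {subset w <= Ps} & P = foldr mulmx 1%:M w].

Lemma isProd_word Ps P : isProd Ps P <-> isWord Ps 1 P.
Proof.
split=> [[w [nw [wP ->]]]|[w [sw wP ->]]]; exists w; first by case: w nw wP.
by case: w sw wP.
Qed.

Lemma isWordW Ps m P : isWord Ps m.+1 P -> isWord Ps m P.
Proof. by case=> w [/ltnW sw wP ->]; exists w. Qed.

Lemma isWordM Ps m m' P Q :
  isWord Ps m P -> isWord Ps m' Q -> isWord Ps (m + m') (P *m Q).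
Proof.
case=> [w [sw wP ->]] [w' [sw' wP' ->]]; exists (w ++ w').
rewrite foldr_mulmx_cat size_cat leq_add //; split=> // Z.
by rewrite mem_cat => /orP[/wP|/wP'].
Qed.

Lemma isProdM Ps P Q : isProd Ps P -> isProd Ps Q -> isProd Ps (P *m Q).
Proof. by rewrite !isProd_word => wP wQ; apply/isWordW/(isWordM wP wQ). Qed.

Lemma isProd1 Ps P : P \in Ps -> isProd Ps P.
Proof.
by move=> PP; exists [:: P]; rewrite /= mulmx1; split; [|split=> // Z; rewrite inE => /eqP->].
Qed.

Lemma isProd_ind Ps (S : 'M[k]_t -> Prop) P :
  (forall Q, Q \in Ps -> S Q) -> (forall Q Q', S Q -> S Q' -> S (Q *m Q')) ->
  isProd Ps P -> S P.
Proof.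
move=> SP SM [w [nw [wP ->]]]; elim: w nw wP => // Q w IHw _ wP /=.
have SQ : S Q by apply/SP/wP; rewrite mem_head.
have [->|nw] := eqVneq w [::]; first by rewrite mulmx1.
by apply: SM => //; apply: IHw => // Z wZ; apply: wP; rewrite inE wZ orbT.
Qed.

Lemma isWord_strict Ps m P : (forall Q, Q \in Ps -> strict_upper Q) ->
  isWord Ps m P -> forall i j : 'I_t, (j < i + m)%N -> P i j = 0.
Proof.
move=> sPs [w [sw wP ->]] i j ltj.
have {ltj} : (j < i + size w)%N by rewrite (leq_trans ltj) // leq_add2l.
elim: w wP i {sw} => [|Q w IHw] wP i /=; first by rewrite addn0 mxE -val_eqE => /gtn_eqF->.
move=> ltj; rewrite mxE big1 // => l _; case: (leqP l i) => [leli|ltil].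
  by rewrite (sPs Q) ?mul0r // wP ?mem_head.
rewrite IHw ?mulr0 // => [Z wZ|]; first by apply: wP; rewrite inE wZ orbT.
by rewrite (leq_trans ltj) // -addSnnS leq_add2r.
Qed.

Lemma gen_alg_subalgebra eqv Ps : subalgebra (gen_alg eqv Ps).
Proof.
split; first split; last split.
- by move=> G subG _ _; apply: subG.1.1.
- split=> [X Y GX GY|c X GX] G subG GP GE.
    by apply: subG.1.2.1; [apply: GX | apply: GY].
  by apply: subG.1.2.2; apply: GX.
- by move=> G subG _ _; apply: subG.2.1.
- move=> X Y GX GY G subG GP GE.
  by apply: subG.2.2; [apply: GX | apply: GY].
Qed.

Lemma gen_bimod_subspace Ps Vs : subspace (gen_bimod Ps Vs).
Proof.
split; last split.
- by move=> W subW _ _; apply: subW.1.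
- by move=> X Y WX WY W subW WV WP; apply: subW.2.1; [apply: WX | apply: WY].
- by move=> c X WX W subW WV WP; apply: subW.2.2; apply: WX.
Qed.

Lemma gen_bimodM Ps Vs P X : isProd Ps P -> gen_bimod Ps Vs X ->
  gen_bimod Ps Vs (P *m X) /\ gen_bimod Ps Vs (X *m P).
Proof.
move=> PP; move: X; apply: (isProd_ind (S := fun P => forall X, gen_bimod Ps Vs X ->
  gen_bimod Ps Vs (P *m X) /\ gen_bimod Ps Vs (X *m P))) PP => [Q PQ X MX|Q Q' HQ HQ' X MX].
  by split=> W subW WV WP; have [] := WP Q X PQ (MX W subW WV WP).
have [Q'X XQ'] := HQ' X MX; have [QX XQ] := HQ X MX.
have [QQ'X _] := HQ _ Q'X; have [_ XQQ'] := HQ' _ XQ.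
by rewrite [X *m _]mulmxA -mulmxA.
Qed.

End Words.

Section Triple.
Variables (k : fieldType) (t : nat) (eqv : rel 'I_t) (Ps Vs : seq 'M[k]_t).
Hypothesis triple : is_triple eqv Ps Vs.
Local Notation R := (inSpan (isProd Ps)).
Implicit Types (P X Y S : 'M[k]_t).

Let eqvE : equivalence_rel eqv := triple.1.

Lemma triple_strict P : P \in Ps -> strict_upper P.
Proof. by case/triple.2.1=> *; apply: nilpotent_upper_strict. Qed.

Lemma isProd_links P : isProd Ps P -> links_some eqv P.
Proof. by apply: isProd_ind => [Q /triple.2.1[]//|Q Q']; apply: links_some_mulmx. Qed.

Lemma inV_links V : inV Ps Vs V -> links_some eqv V.
Proof.
case=> P [P' [V0 [/triple.2.2 lV hP hP' ->]]].
have lPV : links_some eqv (P *m V0).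
  by case: hP => [->|/isProd_links lP]; [rewrite mul1mx | apply: links_some_mulmx].
by case: hP' => [->|/isProd_links lP]; [rewrite mulmx1 | apply: links_some_mulmx].
Qed.

Lemma inSpan_prod_strict X : R X -> strict_upper X.
Proof.
apply: inSpan_min => [|P /isProd_word PP i j leji].
  split=> [i j _|]; first by rewrite mxE.
  split=> [Y Z sY sZ i j leji|c Y sY i j leji]; rewrite !mxE ?sY ?sZ ?addr0 ?mulr0 //.
by apply: (isWord_strict triple_strict PP); rewrite addn1.
Qed.

Lemma inSpan_prodM X Y : R X -> R Y -> R (X *m Y).
Proof.
move=> RX RY; have [R0 [RD RZ]] := inSpan_subspace (isProd Ps).
apply: (inSpan_min (S := fun X => R (X *m Y))) RX => [|P PP].
  split; first by rewrite mul0mx.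
  by split=> [Z Z' RZ1 RZ2|c Z RZ1]; [rewrite mulmxDl; apply: RD | rewrite -scalemxAl; apply: RZ].
apply: (inSpan_lin (f := mulmx P)) RY => Q PQ.
exact/inSpan_gen/isProdM.
Qed.

Lemma inSpan_prod_Ecls a b X : R X -> R (Ecls k eqv a *m X *m Ecls k eqv b).
Proof.
move=> RX; apply: inSpan_Eclsr => //; first exact: isProd_links.
by apply: inSpan_Eclsl => //; apply: isProd_links.
Qed.

(** In (d + M)(d' + M') the cross terms d M' and M d' stay in the span of the words, because words
    link classes and d, d' are class-constant. *)
Lemma split_alg_subalgebra : subalgebra (split_alg eqv R).
Proof.
have [R0 [RD RZ]] := inSpan_subspace (isProd Ps).
have SE := split_algP eqv _ inSpan_prod_strict; split; first split; last split.
- apply/SE; exists 0, 0; rewrite !linear0 addr0; split=> // i j _.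
  by rewrite !mxE.
- split=> [X Y /SE[d [M [cd RM ->]]] /SE[d' [M' [cd' RM' ->]]]|c X /SE[d [M [cd RM ->]]]]; apply/SE.
    exists (d + d'), (M + M'); rewrite linearD addrACA; split=> //.
      by move=> i j eij; rewrite !mxE (cd i j) ?(cd' i j).
    exact: RD.
  exists (c *: d), (c *: M); rewrite linearZ scalerDr; split=> //.
    by move=> i j eij; rewrite !mxE (cd i j).
  exact: RZ.
- apply/SE; exists (const_mx 1), 0; rewrite diag_const_mx addr0; split=> // i j _.
  by rewrite !mxE.
- move=> X Y /SE[d [M [cd RM ->]]] /SE[d' [M' [cd' RM' ->]]]; apply/SE.
  exists (\row_j (d 0 j * d' 0 j)), (diag_mx d *m M' + M *m diag_mx d' + M *m M').
  split; first by move=> i j eij; rewrite !mxE (cd i j) ?(cd' i j).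
    apply: (RD); last exact: inSpan_prodM.
    by apply: RD; [apply: (inSpan_diagl eqvE isProd_links) |
      apply: (inSpan_diagr eqvE isProd_links)].
  by rewrite mulmxDl !mulmxDr mulmx_diag !addrA.
Qed.

(** One inclusion is the minimality of the generated algebra; for the other, a class-constant
    diagonal is a combination of the E_a, and the strict part one of words. *)
Lemma gen_algE S : gen_alg eqv Ps S <-> split_alg eqv R S.
Proof.
have SE := split_algP eqv _ inSpan_prod_strict; split=> [GS|/SE[d [X [cd RX ->]]]].
  apply: GS; first exact: split_alg_subalgebra.
    move=> P PP; apply/SE; exists 0, P; rewrite linear0 add0r.
    by split=> [i j _||//]; [rewrite !mxE | apply/inSpan_gen/isProd1].
  move=> a; apply/SE; exists (\row_j (eqv a j)%:R), 0; rewrite addr0 -Ecls_diag.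
  split=> [i j eij||//]; last exact: (inSpan_subspace _).1.
  by rewrite !mxE eqv_sym // (eqv_left eqvE _ eij) eqv_sym.
have [subG [_ GM]] := gen_alg_subalgebra eqv Ps; apply: subG.2.1.
  rewrite (sum_Ecls eqvE) //; apply: subspace_sum => // a _; apply: subG.2.2.
  by move=> G _ _; apply.
apply: inSpan_min RX => // P; apply: isProd_ind => // Q PQ G _ GP _.
exact: GP.
Qed.

(** The span of the P V P' absorbs a further P_i on either side by lengthening a word. *)
Lemma gen_bimodE X : gen_bimod Ps Vs X <-> inSpan (inV Ps Vs) X.
Proof.
split=> [|MX].
  apply; first exact: inSpan_subspace.
    by move=> V VV; apply: inSpan_gen; exists 1%:M, 1%:M, V; split; rewrite ?mul1mx ?mulmx1; auto.
  move=> P Y PP MY; split.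
    apply: (inSpan_lin (f := mulmx P)) MY => _ [Q [Q' [V [VV hQ hQ' ->]]]].
    apply: inSpan_gen; exists (P *m Q), Q', V; split=> //; last by rewrite /= !mulmxA.
    by right; case: hQ => [->|QQ]; [rewrite mulmx1; apply: isProd1 |
      apply: isProdM => //; apply: isProd1].
  apply: (inSpan_lin (f := mulmxr P)) MY => _ [Q [Q' [V [VV hQ hQ' ->]]]].
  apply: inSpan_gen; exists Q, (Q' *m P), V; split=> //; last by rewrite /= !mulmxA.
  by right; case: hQ' => [->|QQ]; [rewrite mul1mx; apply: isProd1 |
    apply: isProdM => //; apply: isProd1].
apply: inSpan_min MX => [|_ [Q [Q' [V [VV hQ hQ' ->]]]]]; first exact: gen_bimod_subspace.
have MV : gen_bimod Ps Vs V by move=> W _ WV _; apply: WV.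
have MQV : gen_bimod Ps Vs (Q *m V).
  by case: hQ => [->|PQ]; [rewrite mul1mx | exact: (gen_bimodM PQ MV).1].
by case: hQ' => [->|PQ]; [rewrite mulmx1 | exact: (gen_bimodM PQ MQV).2].
Qed.

Lemma gen_bimod_Ecls a b X :
  gen_bimod Ps Vs X -> gen_bimod Ps Vs (Ecls k eqv a *m X *m Ecls k eqv b).
Proof.
rewrite !gen_bimodE => MX; apply: inSpan_Eclsr => //; first exact: inV_links.
by apply: inSpan_Eclsl => //; apply: inV_links.
Qed.

(** [gen_bimod] only imposes stability under the P_i; stability under the diagonal part of S comes
    from the P V P' linking classes. *)
Lemma gen_alg_bimod S X : gen_alg eqv Ps S -> gen_bimod Ps Vs X ->
  gen_bimod Ps Vs (S *m X) /\ gen_bimod Ps Vs (X *m S).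
Proof.
move=> /gen_algE/(split_algP eqv _ inSpan_prod_strict)[d [N [cd RN ->]]] MX.
have subM := gen_bimod_subspace Ps Vs; have [M0 [MD MZ]] := subM.
rewrite mulmxDl mulmxDr; split; apply: (MD).
- apply/gen_bimodE; apply: (inSpan_diagl eqvE inV_links) => //; exact/gen_bimodE.
- apply: (inSpan_min (S := fun N => gen_bimod Ps Vs (N *m X))) RN => [|P PP].
    split; first by rewrite mul0mx.
    by split=> [Y Z MY MZ'|c Y MY]; [rewrite mulmxDl; apply: MD | rewrite -scalemxAl; apply: MZ].
  exact: (gen_bimodM PP MX).1.
- apply/gen_bimodE; apply: (inSpan_diagr eqvE inV_links) => //; exact/gen_bimodE.
- apply: (inSpan_min (S := fun N => gen_bimod Ps Vs (X *m N))) RN => [|P PP].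
    split; first by rewrite mulmx0.
    by split=> [Y Z MY MZ'|c Y MY]; [rewrite mulmxDr; apply: MD | rewrite -scalemxAr; apply: MZ].
  exact: (gen_bimodM PP MX).2.
Qed.

Lemma gen_alg_basic : basic_mx_alg (gen_alg eqv Ps) eqv.
Proof.
have SE := split_algP eqv _ inSpan_prod_strict.
split=> //; first exact: gen_alg_subalgebra.
- split=> S /gen_algE GS; first by case: GS.
  apply/gen_algE/SE; exists (\row_i S i i), 0; rewrite addr0; split.
  + by move=> i j eij; rewrite !mxE; case: GS => _ cS _; apply: cS.
  + exact: (inSpan_subspace _).1.
  + by apply/matrixP=> i j; rewrite !mxE; case: eqP => [->|_]; rewrite ?mul1r ?mul0r.
- move=> D /is_diag_mxP dD; split=> [/gen_algE[]//|cD].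
  apply/gen_algE/SE; exists (\row_i D i i), 0; rewrite addr0; split.
  + by move=> i j eij; rewrite !mxE; apply: cD.
  + exact: (inSpan_subspace _).1.
  + apply/matrixP=> i j; rewrite !mxE; case: eqP => [->//|nij].
    by rewrite mulr0n dD //; apply/eqP => /val_inj.
have [Cs [CsS CsE]] := split_alg_presG eqvE (inSpan_subspace _) inSpan_prod_Ecls.
by exists Cs; split=> // S; rewrite gen_algE.
Qed.

End Triple.

(** * Block similarity *)

Lemma invmx_mul (k : fieldType) m (A B : 'M[k]_m) :
  A \in unitmx -> B \in unitmx -> invmx (A *m B) = invmx B *m invmx A.
Proof.
move=> uA uB; have uAB : A *m B \in unitmx by rewrite unitmx_mul uA.
apply: (can_inj (mulKmx uAB)).
by rewrite mulmxV // mulmxA mulmxK // mulmxV.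
Qed.

Lemma mul_mxdiag (k : fieldType) t (n : 'I_t -> nat) (B C : forall i, 'M[k]_(n i)) :
  \mxdiag_i B i *m \mxdiag_i C i = \mxdiag_i (B i *m C i).
Proof.
rewrite {2}/mxdiag mul_mxdiag_mxblock; apply/eq_mxblockP => i j.
by case: eqP => [<-|_]; rewrite ?conform_mx_id ?mulmx0.
Qed.

Lemma elementary_unitmx (k : fieldType) m (E : 'M[k]_m) : elementary E -> E \in unitmx.
Proof.
case=> [[u [v ->]]|[[u [c [nzc ->]]]|[u [v [c [nuv ->]]]]]].
- exact: unitmx_perm.
- set E1 := \matrix_(_, _) _.
  suff /mulmx1_unit[]: E1 *m diag_mx (\row_a if a == u then c^-1 else 1) = 1%:M by [].
  apply/matrixP=> a b; rewrite mul_mx_diag !mxE; case: eqP => [->|_]; last by rewrite mul0r.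
  by case: eqP => _; rewrite ?mulfV ?mulr1.
- suff /mulmx1_unit[]: (1%:M + c *: delta_mx u v) *m (1%:M - c *: delta_mx u v) = 1%:M by [].
  rewrite mulmxDl mul1mx mulmxBr mulmx1 -scalemxAl -scalemxAr mul_delta_mx_0 1?eq_sym //.
  by rewrite !scaler0 subr0 subrK.
Qed.

(** Equivalent indices have equal but not convertible block sizes; reading entries at natural
    positions copies E from one size to the other without casts. *)
Lemma nth_mx_mul (k : fieldType) m p (E F : 'M[k]_m) : m = p ->
  \matrix_(a < p, b < p) nth_mx (E *m F) a b =
  \matrix_(a < p, b < p) nth_mx E a b *m \matrix_(a < p, b < p) nth_mx F a b.
Proof.
have nthK (G : 'M[k]_m) : \matrix_(a < m, b < m) nth_mx G a b = G.
  by apply/matrixP=> a b; rewrite mxE nth_mxE.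
by case: p /; rewrite !nthK.
Qed.

Section Blocks.
Variables (k : fieldType) (t : nat) (eqv : rel 'I_t) (Ps Vs : seq 'M[k]_t).
Hypothesis triple : is_triple eqv Ps Vs.
Variables (Cs : seq 'M[k]_t).
Hypothesis presCs : presG eqv Cs (gen_alg eqv Ps).
Variable n : 'I_t -> nat.
Hypothesis step : step_seq eqv n.
Implicit Types (S T X Y : 'M[k]_(bsz n)) (V W : 'M[k]_t).
Local Notation R := (inSpan (isProd Ps)).
Local Notation G := (gen_alg eqv Ps).
Local Notation trans := (Relation_Operators.clos_refl_trans _ (tstep eqv Ps n)).

Let eqvE : equivalence_rel eqv := triple.1.
Let SE (A : 'M[k]_t) := split_algP eqv A (inSpan_prod_strict triple).

(** The block conditions have scalar coefficients, so they can be tested separately at each entry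
    position (a, b). *)
Lemma Gblk_slice S : Gblk eqv Cs n S <-> forall a b, G (slice a b S).
Proof.
split=> [[uS cS eS] a b|GS].
  apply/presCs.2; split=> [i j ltji|i j eij|C CCs].
  - by rewrite mxE /bent uS // nth_mx0.
  - by rewrite !mxE; apply: cS.
  - by rewrite -[RHS](eS C CCs a b); do 2!apply: eq_bigr => ? _; rewrite mxE.
split=> [i j ltji|i j eij a b|C CCs a b].
- apply: nth_mx_eq => a b; have [/(_ i j ltji)] := (presCs.2 _).1 (GS a b).
  by rewrite mxE nth_mx0.
- by have [_ /(_ i j eij)] := (presCs.2 _).1 (GS a b); rewrite !mxE.
- have [_ _ /(_ C CCs) e] := (presCs.2 _).1 (GS a b).
  by rewrite -[RHS]e; do 2!apply: eq_bigr => ? _; rewrite mxE.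
Qed.

Lemma Gblk_subalgebra : subalgebra (Gblk eqv Cs n).
Proof.
have [[G0 [GD GZ]] [_ GM]] := gen_alg_subalgebra eqv Ps.
split; first split; last split.
- by apply/Gblk_slice => a b; rewrite linear0.
- split=> [X Y /Gblk_slice GX /Gblk_slice GY|c X /Gblk_slice GX].
    by apply/Gblk_slice => a b; rewrite linearD; exact: (GD _ _ (GX a b) (GY a b)).
  by apply/Gblk_slice => a b; rewrite linearZ; exact: (GZ _ _ (GX a b)).
- apply/Gblk_slice => a b; apply/(gen_algE triple)/SE.
  (* The sizes n_i are constant on classes, hence so is this truncated diagonal. *)
  exists (\row_i ((a == b) && (a < n i)%N)%:R), 0; split.
  + by move=> i j /step eij; rewrite !mxE eij.
  + exact: (inSpan_subspace _).1.
  + by apply/matrixP=> i j; rewrite slice1 addr0 !mxE; case: eqP.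
- move=> X Y /Gblk_slice GX /Gblk_slice GY; apply/Gblk_slice => a b.
  by rewrite sliceM; apply: subspace_sum => // c _; exact: (GM _ _ (GX a c) (GY c b)).
Qed.

Lemma Gblk_invmx S : Gblk eqv Cs n S -> S \in unitmx -> Gblk eqv Cs n (invmx S).
Proof. exact: subalgebra_invmx Gblk_subalgebra. Qed.

Lemma gsim_conj S X :
  Gblk eqv Cs n S -> S \in unitmx -> gsim eqv Cs n X (invmx S *m X *m S).
Proof. by move=> GS uS; exists S; split=> //; apply: Gblk_invmx. Qed.

Lemma gsim_refl X : gsim eqv Cs n X X.
Proof.
have [_ [G1 _]] := Gblk_subalgebra.
by have := gsim_conj X G1 (unitmx1 _ _); rewrite invmx1 mul1mx mulmx1.
Qed.

Lemma gsim_sym X Y : gsim eqv Cs n X Y -> gsim eqv Cs n Y X.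
Proof.
case=> S [GS uS GS' ->]; exists (invmx S); split; rewrite ?invmxK ?unitmx_inv //.
by rewrite !mulmxA mulmxV // mul1mx mulmxK.
Qed.

Lemma gsim_trans X Y Z : gsim eqv Cs n X Y -> gsim eqv Cs n Y Z -> gsim eqv Cs n X Z.
Proof.
case=> S [GS uS _ ->] [T [GT uT _ ->]].
have -> : invmx T *m (invmx S *m X *m S) *m T = invmx (S *m T) *m X *m (S *m T).
  by rewrite invmx_mul // !mulmxA.
apply: gsim_conj; last by rewrite unitmx_mul uS.
exact: Gblk_subalgebra.2.2.
Qed.

Lemma Sdiag_mul i0 (E F : 'M[k]_(n i0)) :
  Sdiag eqv (E *m F) = Sdiag eqv E *m Sdiag eqv F.
Proof.
rewrite mul_mxdiag; apply/eq_mxdiagP => i.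
have [/step en|_] := boolP (eqv i0 i); first exact: nth_mx_mul.
rewrite (_ : \matrix_(a, b) _ = 1%:M) ?mulmx1 //.
by apply/matrixP=> a b; rewrite !mxE.
Qed.

Lemma Sdiag1 i0 : Sdiag eqv (1%:M : 'M[k]_(n i0)) = 1%:M.
Proof.
rewrite -mxdiagZ; apply/eq_mxdiagP => i; apply/matrixP=> a b; rewrite !mxE.
case: ifP => // /step en; have lt c : (c < n i -> c < n i0)%N by rewrite en.
by rewrite (nth_mxE _ (Ordinal (lt _ (ltn_ord a))) (Ordinal (lt _ (ltn_ord b)))) mxE.
Qed.

Lemma Sdiag_unitmx i0 (E : 'M[k]_(n i0)) : E \in unitmx -> Sdiag eqv E \in unitmx.
Proof.
move=> uE; suff /mulmx1_unit[]: Sdiag eqv E *m Sdiag eqv (invmx E) = 1%:M by [].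
by rewrite -Sdiag_mul mulmxV // Sdiag1.
Qed.

Lemma Sdiag_Gblk i0 (E : 'M[k]_(n i0)) : Gblk eqv Cs n (Sdiag eqv E).
Proof.
apply/Gblk_slice => a b; apply/(gen_algE triple)/SE.
exists (\row_i if eqv i0 i then nth_mx E a b else ((a == b) && (a < n i)%N)%:R), 0.
split; last by apply/matrixP=> i j; rewrite slice_Sdiag // addr0 !mxE mulrb; case: eqP => // ->.
  by move=> i j eij; rewrite !mxE (eqv_sym eqvE) (eqv_left eqvE _ eij) (eqv_sym eqvE) (step eij).
exact: (inSpan_subspace _).1.
Qed.

Lemma valid_lr_mul V W l r l' r' : valid_lr eqv n V l r -> valid_lr eqv n W l' r' ->
  valid_lr eqv n (V *m W) l r'.
Proof.
case=> i0 [j0 [lV ltl _]] [i1 [j1 [lW _ ltr]]]; exists i0, j1.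
by split=> //; apply: links_mulmx lV lW.
Qed.

(** These matrices multiply as matrix units with coefficients in k^(t x t). *)
Lemma mx_lr_mul V W l r l' r' : valid_lr eqv n V l r -> valid_lr eqv n W l' r' ->
  mx_lr n V l r *m mx_lr n W l' r' = if r == l' then mx_lr n (V *m W) l r' else 0.
Proof.
move=> vV vW; apply: slice_inj => a b; rewrite sliceM.
rewrite (eq_bigr _ (fun (c : 'I_(\max_i n i)) _ => congr2 mulmx (slice_mx_lr_valid step a c vV)
  (slice_mx_lr_valid step c b vW))).
have [i0 [j0 [_ _ ltr]]] := vV.
(* Validity puts r in the range of the inner sum, so its term does occur. *)
have ltN : (r < \max_i n i)%N by apply: leq_trans ltr _; apply: leq_bigmax.
rewrite (bigD1 (Ordinal ltN)) //= eqxx andbT big1 ?addr0 => [|c nc]; last first.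
  by rewrite [c == r :> nat](negPf nc) andbF mul0mx.
have [Er|_] := eqVneq r l'; last by rewrite /= !linear0.
rewrite (slice_mx_lr_valid step); last exact: valid_lr_mul vV vW.
by do 2![case: eqP => _ /=]; rewrite ?mul0mx ?mulmx0.
Qed.

(* 0 is included to make the layers multiplicative. *)
Definition layer i (Z : 'M[k]_(bsz n)) := Z = 0 \/ exists V l r,
  [/\ isWord Ps i V, V != 0, valid_lr eqv n V l r & Z = mx_lr n V l r].

Lemma layerS i Z : layer i.+1 Z -> layer i Z.
Proof.
case=> [->|[V [l [r [wV nzV val ->]]]]]; [by left | right; exists V, l, r].
by split=> //; apply: isWordW.
Qed.

Lemma layerM i j Y Z : layer i Y -> layer j Z -> layer (i + j) (Y *m Z).
Proof.
case=> [->|[V [l [r [wV nzV vV ->]]]]]; first by left; rewrite mul0mx.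
case=> [->|[W [l' [r' [wW nzW vW ->]]]]]; first by left; rewrite mulmx0.
rewrite mx_lr_mul //; case: ifP => _; last by left.
have [->|nz] := eqVneq (V *m W) 0; first by left; rewrite mx_lr0.
right; exists (V *m W), l, r'; split=> //; first exact: isWordM.
exact: valid_lr_mul vV vW.
Qed.

Lemma layer0 i Z : (t <= i)%N -> layer i Z -> Z = 0.
Proof.
move=> leti [//|[V [l [r [wV /eqP[]]]]]]; apply/matrixP=> u v; rewrite mxE.
apply: (isWord_strict (triple_strict triple) wV).
by rewrite (leq_trans (ltn_ord v)) // (leq_trans leti) // leq_addl.
Qed.

Lemma layer_unitmx a Z : layer 1 Z -> 1%:M + a *: Z \in unitmx.
Proof. exact: (filtered_unitmx layerM layer0). Qed.

Lemma layer_Gblk a Z : layer 1 Z -> Gblk eqv Cs n (1%:M + a *: Z).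
Proof.
have [[G0 [GD GZ]] [G1 _]] := Gblk_subalgebra.
case=> [->|[V [l [r [/isProd_word PV _ val ->]]]]]; first by rewrite scaler0 addr0.
apply: (GD _ _ G1); apply: (GZ a); apply/Gblk_slice => u v.
rewrite (slice_mx_lr_valid step) //; case: ifP => _; last first.
  exact: (gen_alg_subalgebra _ _).1.1.
apply: (isProd_ind _ (gen_alg_subalgebra _ _).2.2) PV => Q PQ H _ HP _.
exact: HP.
Qed.

Lemma tstep_gsim X Y : tstep eqv Ps n X Y -> gsim eqv Cs n X Y.
Proof.
case=> [[i0 [E [/elementary_unitmx uE ->]]]|[P [a [l [r [PP nzP val ->]]]]]].
  by apply: gsim_conj; [apply: Sdiag_Gblk | apply: Sdiag_unitmx].
have LP : layer 1 (mx_lr n P l r) by right; exists P, l, r; split=> //; apply/isProd_word.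
by apply: gsim_conj; [apply: layer_Gblk | apply: layer_unitmx].
Qed.

Lemma trans_gsim X Y : trans X Y -> gsim eqv Cs n X Y.
Proof.
elim=> {X Y} [X Y|X|X Y Z _ XY _ YZ]; first exact: tstep_gsim.
  exact: gsim_refl.
exact: gsim_trans XY YZ.
Qed.

(** Quantifying over all X makes the notion compose: in a product, a later factor acts on the matrix
    already transformed by the earlier ones. *)
Definition reachable S := S \in unitmx /\ forall X, trans X (invmx S *m X *m S).

Lemma reachable_mul T S : T \in unitmx ->
  (forall X, tstep eqv Ps n X (invmx T *m X *m T)) -> reachable S -> reachable (T *m S).
Proof.
move=> uT stT [uS reachS]; split=> [|X]; first by rewrite unitmx_mul uT.
apply: rt_trans (rt_step _ _ _ _ (stT X)) _.
by rewrite invmx_mul //; have := reachS (invmx T *m X *m T); rewrite !mulmxA.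
Qed.

Lemma reachable1 : reachable 1%:M.
Proof.
by split=> [|X]; [apply: unitmx1 | rewrite invmx1 mul1mx mulmx1; apply: rt_refl].
Qed.

Lemma reachable_layer a Z S : layer 1 Z -> reachable S -> reachable ((1%:M + a *: Z) *m S).
Proof.
move=> LZ; case: (LZ) => [->|[P [l [r [/isProd_word PP nzP val DZ]]]]].
  by rewrite scaler0 addr0 mul1mx.
apply: reachable_mul => [|X]; first exact: layer_unitmx.
by right; exists P, a, l, r; rewrite DZ.
Qed.

(** [inSpan_slice] places S in the span of layer 1, where [filtered_generate] applies with
    [reachable] as the closed predicate. *)
Lemma reachable_unipotent S :
  (forall a b, R (slice a b S)) -> reachable (1%:M + S).
Proof.
move=> /(inSpan_slice step _ (isProd_links triple)) RS.
rewrite -[_ + _]mulmx1.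
apply: (filtered_generate layerS layerM layer0 reachable_layer) reachable1.
apply: inSpan_sub RS => _ [V [l [r [/isProd_word wV nzV val ->]]]].
by apply: inSpan_gen; right; exists V, l, r.
Qed.

Lemma reachable_Sdiag i0 (E : 'M[k]_(n i0)) S :
  E \in unitmx -> reachable S -> reachable (Sdiag eqv E *m S).
Proof.
(* Elimination on E starts from the trivial [Sdiag] of 1; as [Sdiag] is multiplicative, each
   elementary factor becomes a transformation (i). *)
move=> uE; rewrite -[E]mulmx1 => HS.
apply: (unitmx_generate (H := fun F => reachable (Sdiag eqv F *m S))) => //.
  move=> F F' elF; rewrite Sdiag_mul -mulmxA; apply: reachable_mul => [|X].
    exact/Sdiag_unitmx/elementary_unitmx.
  by left; exists i0, F.
by rewrite Sdiag1 mul1mx.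
Qed.

(* One factor Sdiag per class, indices of an already treated class contributing nothing. *)
Lemma reachable_mxdiag (B : forall i, 'M[k]_(n i)) S :
  (forall i, B i \in unitmx) ->
  (forall i j, eqv i j -> forall a b, nth_mx (B i) a b = nth_mx (B j) a b) ->
  reachable S -> reachable (\mxdiag_i B i *m S).
Proof.
move=> uB cB HS.
rewrite (_ : \mxdiag_i B i =
    \mxdiag_i (if has (eqv^~ i) (enum 'I_t) then B i else 1%:M)); last first.
  apply/eq_mxdiagP => i; case: hasP => // -[]; exists i; rewrite ?mem_enum //.
  exact: eqv_refl.
elim: (enum 'I_t) => [|i0 s IHs]; first by rewrite mxdiagZ mul1mx.
have [/hasP[j js ej]|ns] := boolP (has (eqv^~ i0) s).
  rewrite (_ : \mxdiag_i _ = \mxdiag_i (if has (eqv^~ i) s then B i else 1%:M)) //.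
  apply/eq_mxdiagP => i /=; have [e|//] := boolP (eqv i0 i).
  suff ->: has (eqv^~ i) s by [].
  by apply/hasP; exists j; rewrite // (eqv_left eqvE _ ej).
rewrite (_ : \mxdiag_i _ =
    Sdiag eqv (B i0) *m \mxdiag_i (if has (eqv^~ i) s then B i else 1%:M)).
  by rewrite -mulmxA; apply: reachable_Sdiag.
rewrite mul_mxdiag; apply/eq_mxdiagP => i /=.
have [e|_] /= := boolP (eqv i0 i); last first.
  rewrite (_ : \matrix_(a, b) _ = 1%:M) ?mul1mx //.
  by apply/matrixP=> a b; rewrite !mxE.
(* i is equivalent to i0, whose class is absent from s, so the remaining factor has an identity
   block at i. *)
rewrite (negPf (_ : ~~ has (eqv^~ i) s)).
  by rewrite mulmx1; apply/matrixP=> a b; rewrite mxE (cB _ _ e) nth_mxE.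
apply: contra ns => /hasP[j js ej]; apply/hasP; exists j => //.
by rewrite (eqv_left eqvE _ ej) (eqv_sym eqvE).
Qed.

(** For l different from i, one of the blocks S_il and T_li lies below the diagonal and vanishes. *)
Lemma mxdiag_submxblock S T : Gblk eqv Cs n S -> Gblk eqv Cs n T ->
  \mxdiag_i submxblock S i i *m \mxdiag_i submxblock T i i =
  \mxdiag_i submxblock (S *m T) i i.
Proof.
move=> [uS _ _] [uT _ _]; rewrite mul_mxdiag; apply/eq_mxdiagP => i.
rewrite -{2}(submxblockK S) -{2}(submxblockK T) mul_mxblock mxblockK.
rewrite (bigD1 i) //= big1 ?addr0 // => l nli.
case: (ltngtP l i) nli => [/uS->|/uT->|/val_inj->]; rewrite ?mul0mx ?mulmx0 //.
by rewrite eqxx.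
Qed.

(** S = D (D' S), where D and D' are the block diagonals of S and of its inverse. They are inverse
    to each other, D is a product of class-wise factors, and D' S is unipotent. *)
Lemma Gblk_reachable S : Gblk eqv Cs n S -> S \in unitmx -> reachable S.
Proof.
move=> GS uS; have GS' := Gblk_invmx GS uS.
set D := \mxdiag_i submxblock S i i; set D' := \mxdiag_i submxblock (invmx S) i i.
have submx1 i : submxblock (1%:M : 'M[k]_(bsz n)) i i = 1%:M.
  by rewrite -mxdiagZ submxblock_diag.
have DD' : D *m D' = 1%:M.
  rewrite mxdiag_submxblock // mulmxV // -[RHS]mxdiagZ.
  by apply/eq_mxdiagP => i; apply: submx1.
have D'D := mulmx1C DD'.
have sliceD T a b : slice a b (\mxdiag_i submxblock T i i) =
    diag_mx (\row_i slice a b T i i).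
  apply/matrixP=> i j; rewrite !mxE /bent mxblockK.
  have [<-|nij] := eqVneq i j; first by rewrite conform_mx_id.
  by rewrite nth_mx0.
rewrite -[S]mul1mx -DD' -mulmxA; apply: reachable_mxdiag => [i|i j eij a b|].
- suff /mulmx1_unit[]: submxblock S i i *m submxblock (invmx S) i i = 1%:M by [].
  have := congr1 (fun Z => submxblock Z i i) DD'.
  by rewrite mul_mxdiag submxblock_diag submx1.
- by case: GS => _ cS _; apply: cS.
rewrite -[_ *m S](subrK 1%:M) addrC; apply: reachable_unipotent => a b.
(* As D' S - 1 = D' (S - D), each slice is a sum of products of a class-constant diagonal, from D',
   with the strict part of a slice of S, which lies in [R]. *)
rewrite -D'D -mulmxBr sliceM; apply: subspace_sum => [|c _]; first exact: inSpan_subspace.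
rewrite linearB /= !sliceD.
have /(gen_algE triple)[u _ RS] := (Gblk_slice S).1 GS c b.
rewrite {1}(upper_split u) addrC addKr.
apply: (inSpan_diagl eqvE (isProd_links triple)) => // i j eij.
by rewrite !mxE; case: GS' => _ cS _; apply: cS.
Qed.

(** The backward alternative of [tequiv] is absorbed by the symmetry of [gsim]; in the converse
    direction a forward chain always exists. *)
Lemma tequiv_gsim X Y : tequiv eqv Ps n X Y <-> gsim eqv Cs n X Y.
Proof.
split=> [[/trans_gsim//|/trans_gsim/gsim_sym//]|[S [GS uS _ ->]]].
by left; apply: (Gblk_reachable GS uS).2.
Qed.

(** Both sides say that every slice of X lies in the bimodule, described once as a span and once by
    equations. *)
Lemma Mtr_Mblk (Ds : seq 'M[k]_t) : presM eqv Ds (gen_bimod Ps Vs) ->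
  forall X, Mtr eqv Ps Vs n X <-> Mblk Ds n X.
Proof.
move=> [_ MDs] X; rewrite /Mtr (inSpan_slice step _ (inV_links triple)).
have slE D a b : mxdot D (slice a b X) = \sum_i \sum_j D i j * bent X i j a b.
  by do 2!apply: eq_bigr => ? _; rewrite mxE.
split=> [MX D DDs a b|MX a b].
  by rewrite -slE; apply: (MDs _).1 DDs; apply/gen_bimodE.
by apply/gen_bimodE/MDs => D DDs; rewrite -/(mxdot _ _) slE MX.
Qed.

End Blocks.

(** * The triple of a linear matrix problem *)

Lemma span_inSpan (k : fieldType) t (B : seq 'M[k]_t) X :
  X \in <<B>>%VS -> inSpan (fun Y => Y \in B) X.
Proof.
move=> BX; rewrite (coord_span (X := in_tuple B) BX).
have [_ [_ BZ]] := inSpan_subspace (fun Y => Y \in B).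
apply: subspace_sum => [|i _]; first exact: inSpan_subspace.
by apply/BZ/inSpan_gen/mem_nth.
Qed.

Section Converse.
Variables (k : fieldType) (t : nat) (eqv : rel 'I_t) (G M : 'M[k]_t -> Prop).
Variables (Cs Ds : seq 'M[k]_t).
Hypotheses (linGM : lin_mx_problem G eqv M) (presCs : presG eqv Cs G).
Variable reps : seq 'I_t.
Hypothesis repsP : class_reps eqv reps.
Variables BR BM : 'I_t -> 'I_t -> seq 'M[k]_t.
Hypotheses
  (basisR : forall a b, a \in reps -> b \in reps ->
     is_basis (sandwich eqv (Rad G) a b) (BR a b))
  (basisM : forall a b, a \in reps -> b \in reps ->
     is_basis (sandwich eqv M a b) (BM a b)).
Variables Ps Vs : seq 'M[k]_t.
Hypotheses (PsE : Ps =i flatten [seq BR a b | a <- reps, b <- reps])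
           (VsE : Vs =i flatten [seq BM a b | a <- reps, b <- reps]).
Local Notation E := (Ecls k eqv).

Let basicG : basic_mx_alg G eqv. Proof. by case: linGM. Qed.
Let eqvE : equivalence_rel eqv. Proof. by case: basicG. Qed.
Let subalgG : subalgebra G. Proof. by case: basicG. Qed.
Let subM : subspace M. Proof. by case: linGM. Qed.

Lemma mem_flatten_reps (B : 'I_t -> 'I_t -> seq 'M[k]_t) X :
  X \in flatten [seq B a b | a <- reps, b <- reps] <->
  exists a b, [/\ a \in reps, b \in reps & X \in B a b].
Proof.
split=> [/flattenP[_ /allpairsP[[a b] /= [ra rb ->]] BX]|[a [b [ra rb BX]]]].
  by exists a, b.
by apply/flattenP; exists (B a b) => //; apply: allpairs_f.
Qed.

Lemma mem_basis (S : 'M[k]_t -> Prop) B X : is_basis S B -> X \in B -> S X.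
Proof. by case=> _ SB BX; apply/SB/memv_span. Qed.

Lemma Ecls_lin_mx_alg a : G (E a).
Proof.
rewrite Ecls_diag; case: basicG => _ _ _ diagG _.
apply/diagG; first exact: diag_mx_is_diag.
by move=> i j eij; rewrite !mxE !eqxx (eqv_sym eqvE) (eqv_left eqvE _ eij) (eqv_sym eqvE).
Qed.

Lemma radical_strict X : Rad G X -> strict_upper X.
Proof.
case=> GX X0 i j; rewrite leq_eqVlt => /predU1P[/val_inj->//|].
by case: basicG => _ _ [uG _] _ _; apply: uG.
Qed.

Lemma mem_radical_basis P : P \in Ps ->
  Rad G P /\ exists a b, links eqv P a b.
Proof.
rewrite PsE => /mem_flatten_reps[a [b [ra rb /(mem_basis (basisR ra rb))]]].
case=> Y [[GY Y0] ->]; split; last by exists a, b; apply: links_Ecls.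
split; last by move=> i; rewrite mul_EclsEcls Y0 if_same.
by do 2?apply: subalgG.2.2 => //; apply: Ecls_lin_mx_alg.
Qed.

Lemma mem_bimod_basis V : V \in Vs -> M V /\ exists a b, links eqv V a b.
Proof.
rewrite VsE => /mem_flatten_reps[a [b [ra rb /(mem_basis (basisM ra rb))]]].
case=> Y [MY ->]; split; last by exists a, b; apply: links_Ecls.
case: linGM => _ _ GM _.
by apply: (GM _ _ (Ecls_lin_mx_alg b) _).2; apply: (GM _ _ (Ecls_lin_mx_alg a) MY).1.
Qed.

Lemma lin_mx_problem_triple : is_triple eqv Ps Vs.
Proof.
split=> //; split=> [P /mem_radical_basis[RP linkP]|V /mem_bimod_basis[]//].
have sP := radical_strict RP; split=> //; first exact: nilpotent_strict.
by move=> i j ltji; apply: sP; apply: ltnW.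
Qed.

(** E_a depends only on the class of a, so a and b may be traded for listed representatives. *)
Lemma sandwich_rep (S : 'M[k]_t -> Prop) a b X : S X ->
  exists a' b', [/\ a' \in reps, b' \in reps & sandwich eqv S a' b' (E a *m X *m E b)].
Proof.
move=> SX; have [a' ra' eaa'] := repsP.1 a; have [b' rb' ebb'] := repsP.1 b.
exists a', b'; split=> //; exists X; split=> //.
by rewrite (Ecls_eqv k eqvE eaa') (Ecls_eqv k eqvE ebb').
Qed.

(** The diagonal of an element of G lies in G, so the strict part lies in the radical, whose Peirce
    corners are spanned by the chosen bases. *)
Lemma gen_alg_lin_mx_alg S : G S <-> gen_alg eqv Ps S.
Proof.
split=> [GS|]; last first.
  apply=> //; last exact: Ecls_lin_mx_alg.
  by move=> P /mem_radical_basis[[]].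
have [uS cS _] := (presCs.2 S).1 GS.
apply/(gen_algE lin_mx_problem_triple); split=> //.
have radS : Rad G (strict_part S).
  split; last by move=> i; rewrite mxE ltnn.
  have -> : strict_part S = S - diag_mx (\row_i S i i).
    by rewrite {2}(upper_split uS) addrC addKr.
  apply: subspaceB => //; first exact: subalgG.1.
  case: basicG => _ _ _ diagG _; apply/diagG; first exact: diag_mx_is_diag.
  by move=> i j eij; rewrite !mxE !eqxx (cS i j).
apply: (subspace_homogeneous eqvE (inSpan_subspace _)) => a b.
have [a' [b' [ra rb]]] := sandwich_rep a b radS.
move/(basisR ra rb).2/span_inSpan; apply: inSpan_sub => P BP.
by apply/inSpan_gen/isProd1; rewrite PsE; apply/mem_flatten_reps; exists a', b'.
Qed.

(** The V_j span all Peirce corners of M; conversely M is stable under the P_i because these lie in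
    G. *)
Lemma gen_bimod_lin_mx_problem X : M X <-> gen_bimod Ps Vs X.
Proof.
split=> [MX|]; last first.
  apply=> // [V /mem_bimod_basis[]//|P Y /mem_radical_basis[[GP _] _] MY].
  by case: linGM => _ _ GM _; apply: GM.
apply: (subspace_homogeneous eqvE (gen_bimod_subspace _ _)) => a b.
have [a' [b' [ra rb]]] := sandwich_rep a b MX.
move/(basisM ra rb).2/span_inSpan; apply: inSpan_min => [|V BV].
  exact: gen_bimod_subspace.
move=> W _ WV _; apply: WV; rewrite VsE; apply/mem_flatten_reps.
by exists a', b'.
Qed.

End Converse.

Theorem theorem2p1 (k : closedFieldType) :
  (* (a) *)
  (forall (t : nat) (eqv : rel 'I_t) (Ps Vs : seq 'M[k]_t),
    is_triple eqv Ps Vs ->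
    [/\ basic_mx_alg (gen_alg eqv Ps) eqv,
        (forall S X, gen_alg eqv Ps S -> gen_bimod Ps Vs X ->
           gen_bimod Ps Vs (S *m X) /\ gen_bimod Ps Vs (X *m S)),
        (exists Ds, presM eqv Ds (gen_bimod Ps Vs)) &
        forall (Cs Ds : seq 'M[k]_t),
          presG eqv Cs (gen_alg eqv Ps) -> presM eqv Ds (gen_bimod Ps Vs) ->
          forall n : 'I_t -> nat, step_seq eqv n ->
            (forall X : 'M[k]_(bsz n), Mtr eqv Ps Vs n X <-> Mblk Ds n X) /\
            (forall X Y, Mtr eqv Ps Vs n X -> Mtr eqv Ps Vs n Y ->
               (tequiv eqv Ps n X Y <-> gsim eqv Cs n X Y))]) /\
  (* (b) *)
  (forall (t : nat) (eqv : rel 'I_t) (G M : 'M[k]_t -> Prop) (Cs Ds : seq 'M[k]_t),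
    lin_mx_problem G eqv M -> presG eqv Cs G -> presM eqv Ds M ->
    forall (reps : seq 'I_t), class_reps eqv reps ->
    forall (BR BM : 'I_t -> 'I_t -> seq 'M[k]_t),
      (forall a b, a \in reps -> b \in reps ->
         is_basis (sandwich eqv (Rad G) a b) (BR a b)) ->
      (forall a b, a \in reps -> b \in reps ->
         is_basis (sandwich eqv M a b) (BM a b)) ->
    forall (Ps Vs : seq 'M[k]_t),
      Ps =i flatten [seq BR a b | a <- reps, b <- reps] ->
      Vs =i flatten [seq BM a b | a <- reps, b <- reps] ->
      is_triple eqv Ps Vs /\
      forall n : 'I_t -> nat, step_seq eqv n ->
        (forall X : 'M[k]_(bsz n), Mtr eqv Ps Vs n X <-> Mblk Ds n X) /\
        (forall X Y, Mtr eqv Ps Vs n X -> Mtr eqv Ps Vs n Y ->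
           (tequiv eqv Ps n X Y <-> gsim eqv Cs n X Y))).
Proof.
split=> [t eqv Ps Vs triple|t eqv G M Cs Ds linGM presCs presDs reps repsP BR BM].
  split; first exact: gen_alg_basic triple.
  - by move=> S X; apply: gen_alg_bimod.
  - apply: homogeneous_presM triple.1 _ (gen_bimod_subspace Ps Vs) _ => a b X.
    exact: gen_bimod_Ecls.
  - move=> Cs Ds presCs presDs n step; split; first exact: (Mtr_Mblk triple step presDs).
    by move=> X Y _ _; apply: (tequiv_gsim triple presCs step).
move=> basisR basisM Ps Vs PsE VsE.
have triple : is_triple eqv Ps Vs.
  exact: (lin_mx_problem_triple linGM basisR basisM PsE VsE).
split=> // n step; split.
  (* M is the bimodule generated by the triple, so the given [Ds] present the latter and the direct
     result applies. *)
  apply: (Mtr_Mblk triple step); split=> [|X]; first exact: presDs.1.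
  by rewrite -presDs.2 (gen_bimod_lin_mx_problem linGM repsP basisR basisM PsE VsE).
move=> X Y _ _; apply: (tequiv_gsim triple _ step); split=> [|S]; first exact: presCs.1.
by rewrite -presCs.2 (gen_alg_lin_mx_alg linGM presCs repsP basisR basisM PsE VsE).
Qed.
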